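(* For real $p\ge n>0$ put $$\Sigma_{pn}:=\Big(1+2\sqrt{\tfrac np}+\tfrac{5n}{4p}\Big)^p+\Big(1+2\sqrt{\tfrac np}+\tfrac{2n}p\Big)^p+\tfrac12\Big(\tfrac np\Big)^p,$$ $$\Upsilon_{pn}:=\Big(1+2\sqrt{\tfrac np}+\tfrac{2n}p\Big)^n+\frac1{2^{2p-2n}}\Big(1+2\sqrt{\tfrac np}+\tfrac{5n}{4p}\Big)^n+\tfrac12\Big(\tfrac np\Big)^n.$$ (i) Let $d\ge3$. For all real $p,n$ with $p\ge n>d/2+1$ one has $G_{pn}\ge G^{\langle-\rangle}_{pn}$, where $$G^{\langle-\rangle}_{pn}:=\frac{\sqrt2}{(2\pi)^{d/2}}\Big(\frac np\Big)^{n/2}\frac{\big(1+\frac n{4p}\big)^p2^p+\big(1-\frac1{2^p}\big)\big(1+\frac np\big)^p-\big(\frac np\big)^p}{\Big(\big(1+\sqrt{\frac np}\big)^p\Upsilon_{pn}^{1/2}+\big(1+\sqrt{\frac np}\big)^n\Sigma_{pn}^{1/2}\Big)\Sigma_{pn}^{1/2}}.$$ (ii) Let again $d\ge3$, with $G^{\langle-\rangle}_{pn}$ as in (i). For fixed $n>d/2+1$ and $p\to+\infty$, $$G^{\langle-\rangle}_{pn}\sim\frac{\sqrt2}{(2\pi)^{d/2}}\,\frac{e^{9n/8}}{(1+e^{n/8}\sqrt{1+e^{3n/4}})\sqrt{1+e^{3n/4}}}\Big(\frac np\Big)^{n/2}\frac{2^p}{e^{2\sqrt{np}}}$$ and $(G^{\langle-\rangle}_{pn})^{1/p}\to2$.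 (iii) Let $d=2$. For all real $p,n$ with $p\ge n>2$ one has $G_{pn}\ge G^{\langle-\rangle}_{pn}$, where $$G^{\langle-\rangle}_{pn}:=\frac{\big(\frac np\big)^{n/2+1}}{\sqrt2\,\pi\sqrt{(1+\frac np)(1+\frac{4n}p)}}\cdot\frac{15\big(1+\frac n{4p}\big)^{p-1}2^{p-2}+\big(1+\frac np\big)^{p-1}\Big(2\sqrt{1+\frac{4n}p}-\frac3{2^{p-1}}\Big)-\sqrt{1+\frac{4n}p}\,\big(\frac np\big)^{p-1}}{\Big(\big(1+\sqrt{\frac np}\big)^p\Upsilon_{pn}^{1/2}+\big(1+\sqrt{\frac np}\big)^n\Sigma_{pn}^{1/2}\Big)\Sigma_{pn}^{1/2}}.$$ (iv) Let again $d=2$, with $G^{\langle-\rangle}_{pn}$ as in (iii). For fixed $n>2$ and $p\to+\infty$, $$G^{\langle-\rangle}_{pn}\sim\frac{15}{4\sqrt2\,\pi}\,\frac{e^{9n/8}}{(1+e^{n/8}\sqrt{1+e^{3n/4}})\sqrt{1+e^{3n/4}}}\Big(\frac np\Big)^{n/2+1}\frac{2^p}{e^{2\sqrt{np}}}$$ and $(G^{\langle-\rangle}_{pn})^{1/p}\to2$.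
   Context: Notation. $\mathbf T^d=(\mathbf R/2\pi\mathbf Z)^d$; $e_k(x)=(2\pi)^{-d/2}e^{ik\cdot x}$ for $k\in\mathbf Z^d$; $a\cdot b=\sum_ra_rb_r$ and $|a|=\sqrt{\overline a\cdot a}$ on $\mathbf C^d$; $\mathbf Z^d_0=\mathbf Z^d\setminus\{0\}$. An $\mathbf R^d$-valued distribution on $\mathbf T^d$ has a Fourier expansion $v=\sum_kv_ke_k$, $v_k=\overline{v_{-k}}\in\mathbf C^d$. For real $m$, $\mathbb H^m$ is the space of such $v$ with $k\cdot v_k=0$ for all $k$, $v_0=0$ and $\sum_{k\in\mathbf Z^d_0}|k|^{2m}|v_k|^2<\infty$, with inner product $\langle v|w\rangle_m=\sum_{k\in\mathbf Z^d_0}|k|^{2m}\overline{v_k}\cdot w_k$ and norm $\|v\|_m=\sqrt{\langle v|v\rangle_m}$. The Leray projection $\mathfrak L$ acts by $(\mathfrak Lv)_k=v_k-\frac{k\cdot v_k}{|k|^2}k$ for $k\ne0$, $(\mathfrak Lv)_0=v_0$. $\mathcal P(v,w)=\mathfrak L(v\cdot\partial w)$, $(v\cdot\partial w)_s=\sum_{r=1}^dv_r\partial_rw_s$; for $p>d/2$ it maps $\mathbb H^p\times\mathbb H^{p+1}$ to $\mathbb H^p$. For $p\ge n>d/2+1$, $G_{pn}$ is the sharp (i.e. minimum) constant $G$ such that $|\langle\mathcal P(v,w)|w\rangle_p|\le\frac12G(\|v\|_p\|w\|_n+\|v\|_n\|w\|_p)\|w\|_p$ for all $v\in\mathbb H^p$,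 $w\in\mathbb H^{p+1}$ (such constants exist). $f(p)\sim g(p)$ means $f(p)/g(p)\to1$. *)

(* Defs.v *)
From HB Require Import structures.
From mathcomp Require Import all_boot all_order all_algebra.
From mathcomp Require Import complex.
From mathcomp Require Import all_classical all_reals all_analysis.
From mathcomp Require Import summability.

Set Implicit Arguments.
Unset Strict Implicit.
Unset Printing Implicit Defensive.

Import Order.TTheory GRing.Theory Num.Theory.
Import numFieldNormedType.Exports.

Local Open Scope classical_set_scope.
Local Open Scope ring_scope.

Definition dotp (T : pzRingType) (d : nat) (a b : 'rV[T]_d) : T :=
  \sum_(r < d) a 0 r * b 0 r.

Definition zvec (T : pzRingType) (d : nat) (k : 'rV[int]_d) : 'rV[T]_d :=
  map_mx intr k.

Section Torus.
Variables (R : realType) (d : nat).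

Definition cnorm (a : 'rV[R[i]]_d) : R :=
  Num.sqrt (complex.Re (dotp (map_mx (@conjc R) a) a)).

Definition znorm (k : 'rV[int]_d) : R := cnorm (zvec R[i] k).

(* Unordered summation over Z^d: the limit of the partial sums along the
   directed set of finite subsets of Z^d. *)
Definition zsum (f : 'rV[int]_d -> R[i]) : R[i] :=
  @summability.sum _ R[i] (R[i]^o) f.

Definition ek (k : 'rV[int]_d) (x : 'rV[R]_d) : R[i] :=
  real_complex R ((2 * pi) `^ (- (d%:R / 2))) *
  Complex (cos (dotp (zvec R k) x)) (sin (dotp (zvec R k) x)).

(* A distribution v = sum_k v_k e_k on the torus is identified with the family
   of its Fourier coefficients. *)
Definition fourier := 'rV[int]_d -> 'rV[R[i]]_d.

(* The polynomial growth that makes a family of coefficients a distribution is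
   implied by the last condition. *)
Definition Hspace (m : R) : set fourier :=
  [set v | [/\ forall k, v k = map_mx (@conjc R) (v (- k)),
               forall k, dotp (zvec R[i] k) (v k) = 0,
               v 0 = 0
             & (\esum_(k in [set k | k != 0%R])
                 (znorm k `^ (2 * m) * cnorm (v k) ^+ 2)%:E < +oo)%E]].

Definition Hinner (m : R) (v w : fourier) : R[i] :=
  zsum (fun k => if k == 0 then 0 else
    real_complex R (znorm k `^ (2 * m)) *
    dotp (map_mx (@conjc R) (v k)) (w k)).

Definition Hnorm (m : R) (v : fourier) : R :=
  Num.sqrt (complex.Re (Hinner m v v)).

(* Pointwise values of an R^d-valued field; the reality condition
   v_k = conj v_{-k} makes the sum real, so taking real parts only changes
   the type.  For v in Hspace m with m > d/2 the series converges absolutely and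
   uniformly; for m > d/2 + 1 its sum is of class C^1. *)
Definition field (v : fourier) (x : 'rV[R]_d) : 'rV[R]_d :=
  \row_s complex.Re (zsum (fun k => v k 0 s * ek k x)).

Definition partial (r : 'I_d) (f : 'rV[R]_d -> R) (x : 'rV[R]_d) : R :=
  'D_(delta_mx 0 r) f x.

Definition advect (v w : 'rV[R]_d -> 'rV[R]_d) (x : 'rV[R]_d) : 'rV[R]_d :=
  \row_s \sum_(r < d) v x 0 r * partial r (fun y => w y 0 s) x.

End Torus.

(* Integral over the box [0, 2 pi]^d, as an iterated integral. *)
Fixpoint torus_int (R : realType) (d : nat) : ('rV[R]_d -> R) -> R :=
  match d with
  | 0 => fun f => f 0
  | d'.+1 => fun f =>
      Rintegral lebesgue_measure `[0, 2 * pi]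
        (fun t : R => torus_int
           (fun y : 'rV[R]_d' => f (row_mx (const_mx t : 'rV[R]_1) y)))
  end.

Section SharpConstant.
Variables (R : realType) (d : nat).

(* Fourier coefficients: u_k is the integral of u times the conjugate of e_k. *)
Definition fourier_coef (u : 'rV[R]_d -> 'rV[R]_d) : fourier R d := fun k =>
  \row_s Complex
    (torus_int (fun x => u x 0 s * complex.Re (conjc (ek k x))))
    (torus_int (fun x => u x 0 s * complex.Im (conjc (ek k x)))).

Definition leray (v : fourier R d) : fourier R d := fun k =>
  if k == 0 then v 0 else
  v k - (dotp (zvec R[i] k) (v k) / real_complex R (znorm R k ^+ 2))
          *: zvec R[i] k.

Definition calP (v w : fourier R d) : fourier R d :=
  leray (fourier_coef (advect (field v) (field w))).

Definition kato_bound (p n G : R) : Prop :=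
  forall v w : fourier R d, Hspace p v -> Hspace (p + 1) w ->
    complex.Re `|Hinner p (calP v w) w| <=
      2^-1 * G * (Hnorm p v * Hnorm n w + Hnorm n v * Hnorm p w) * Hnorm p w.

Definition is_sharp_constant (p n G : R) : Prop :=
  kato_bound p n G /\ forall G', kato_bound p n G' -> G <= G'.

End SharpConstant.
Arguments is_sharp_constant {R} d p n G.

Section LowerBounds.
Variable R : realType.
Implicit Types p n : R.

Definition Sigma p n : R :=
  (1 + 2 * Num.sqrt (n / p) + 5 * n / (4 * p)) `^ p
  + (1 + 2 * Num.sqrt (n / p) + 2 * n / p) `^ p
  + 2^-1 * (n / p) `^ p.

Definition Upsilon p n : R :=
  (1 + 2 * Num.sqrt (n / p) + 2 * n / p) `^ n
  + (2 `^ (2 * p - 2 * n))^-1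
    * (1 + 2 * Num.sqrt (n / p) + 5 * n / (4 * p)) `^ n
  + 2^-1 * (n / p) `^ n.

Definition Gminus_den p n : R :=
  ((1 + Num.sqrt (n / p)) `^ p * Num.sqrt (Upsilon p n)
   + (1 + Num.sqrt (n / p)) `^ n * Num.sqrt (Sigma p n))
  * Num.sqrt (Sigma p n).

Definition Gminus_dge3 (d : nat) p n : R :=
  Num.sqrt 2 / (2 * pi) `^ (d%:R / 2) * (n / p) `^ (n / 2)
  * (((1 + n / (4 * p)) `^ p * 2 `^ p
      + (1 - (2 `^ p)^-1) * (1 + n / p) `^ p
      - (n / p) `^ p)
     / Gminus_den p n).

Definition Gminus_d2 p n : R :=
  (n / p) `^ (n / 2 + 1)
  / (Num.sqrt 2 * pi * Num.sqrt ((1 + n / p) * (1 + 4 * n / p)))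
  * ((15 * (1 + n / (4 * p)) `^ (p - 1) * 2 `^ (p - 2)
      + (1 + n / p) `^ (p - 1)
        * (2 * Num.sqrt (1 + 4 * n / p) - 3 / 2 `^ (p - 1))
      - Num.sqrt (1 + 4 * n / p) * (n / p) `^ (p - 1))
     / Gminus_den p n).

Definition sim_pinfty (f g : R -> R) : Prop :=
  f p / g p @[p --> +oo] --> (1 : R).

Definition exp_factor n : R :=
  expR (9 * n / 8)
  / ((1 + expR (n / 8) * Num.sqrt (1 + expR (3 * n / 4)))
     * Num.sqrt (1 + expR (3 * n / 4))).

End LowerBounds.

(* Main.v *)
Require Import Defs.
From mathcomp Require Import all_boot all_order all_algebra.
From mathcomp Require Import complex finmap.
From mathcomp Require Import all_classical all_reals all_analysis.
From mathcomp Require Import summability ring lra zify.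
Set Implicit Arguments. Unset Strict Implicit. Unset Printing Implicit Defensive.
Import Order.TTheory GRing.Theory Num.Theory.
Import numFieldNormedType.Exports.
Local Open Scope classical_set_scope.
Local Open Scope ring_scope.

(**
A sharp constant dominates every quotient obtained by inserting particular
fields into the inequality that defines it, so the lower bounds come from one
family of trigonometric test fields.  Let y = sqrt (p / n) and let N be a
natural number with y <= N <= y + 1.  The field v is the shear flow
2 (2 pi)^(-d/2) sin (N x_0) e_1, with Fourier modes at plus and minus
h = (N, 0, .., 0); the field w is the cosine series
2 (2 pi)^(-d/2) sum_j c_j cos (k_j . x) u_j over the five wave vectors
k_j = (j N, 1, 0, .., 0) with |j| <= 2 and unit polarizations u_j orthogonal
to k_j.

Multiplication by sin (N x_0) shifts k_j to its neighbours k_(j+1) and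
k_(j-1), so v . d w couples only neighbouring modes.  As the coupling is
antisymmetric, the link between j and j + 1 enters < P(v,w) | w >_p with the
weight |k_(j+1)|^(2p) - |k_j|^(2p), which has opposite signs on the two halves
of the chain.  The amplitudes c = (2^(-p), -1, 1, 1, 2^(-p)) compensate this by
one sign change: all four links then contribute positively ([kato_chain]).  The
factor 2^(-p) brings the terms of the outermost modes to the size of the
others, because 4^(-p) (4 N^2 + 1)^p = (N^2 + 1/4)^p; the links |k_2|^(2p)
c_2 c_1 are of order 2^p N^(2p), which is where the growth 2^p comes from.

In dimension at least 3 all u_j may be the third basis vector, and the scalar
products of neighbouring polarizations are 1 ([kato_chain_transverse]).  In
the plane u_j = (-1, j N) / |k_j| is forced up to sign, and these products
produce the additional factors of the two-dimensional bound
([kato_chain_planar]).  In both cases the numerator is bounded below by its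
value for y in place of N, and the norms are bounded above by
N <= y (1 + sqrt (n / p)); what remains of N are the powers of n / p in the
statement, and the expressions Sigma and Upsilon ([chain_den_le]).  For d = 2
the comparison of the numerators also needs polynomial inequalities in N^2
([planar_numerator_le]); they hold since N^2 >= p / n >= 1.

The asymptotics rest on (1 + u)^p ~ exp (p u - p u^2 / 2), valid when u -> 0
and p u^2 has a limit ([cvg_powR_expR]).  With s = sqrt (n / p) it gives
(1 + 2 s + c s^2)^p ~ exp (2 sqrt (n p)) exp ((c - 2) n), hence the behaviour
of Sigma; Upsilon tends to 1, and the numerator divided by 2^p tends to a
multiple of exp (n / 4).  Among the factors of the equivalent, only 2^p has a
p-th root that does not tend to 1.
*)

(** * Finite sums over the lattice, the dot product *)

Section FiniteSum.
Variables (R : realType) (d : nat).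

(** The partial sums are constant along the finite sets that contain [s]. *)
Lemma zsum_fin (s : seq 'rV[int]_d) (f : 'rV[int]_d -> R[i]) :
  uniq s -> (forall k, k \notin s -> f k = 0) -> zsum f = \sum_(k <- s) f k.
Proof.
move=> us fs; rewrite /zsum /summability.sum.
apply: (@norm_lim_near_cst _ R[i]^o _ _ (summability.totally_filter)).
exists [fset x in s]%fset; [by []|move=> B /= sB].
rewrite /partial_sum.
rewrite -(big_seq_fsetE _ B predT f) /=.
rewrite (bigID (fun k => k \in s)) /= [X in _ + X]big1 ?addr0; last by move=> k; exact: fs.
rewrite -big_filter; apply/perm_big/uniq_perm => //.
  by rewrite filter_uniq // fset_uniq.
move=> k; rewrite mem_filter; case ks: (k \in s) => //=.
by apply: (fsubsetP sB); rewrite inE.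
Qed.

End FiniteSum.

Section Dotp.
Variable d : nat.

Lemma zvecN (T : pzRingType) (l : 'rV[int]_d) : zvec T (- l) = - zvec T l.
Proof. by apply/rowP => i; rewrite !mxE rmorphN. Qed.

Lemma dotpN (T : pzRingType) (a b : 'rV[T]_d) : dotp (- a) b = - dotp a b.
Proof. by rewrite /dotp -sumrN; apply: eq_bigr => i _; rewrite mxE mulNr. Qed.

Lemma zvecD (T : pzRingType) (l l' : 'rV[int]_d) : zvec T (l + l') = zvec T l + zvec T l'.
Proof. by apply/rowP => i; rewrite !mxE rmorphD. Qed.

Lemma dotpDl (T : pzRingType) (a b c : 'rV[T]_d) : dotp (a + b) c = dotp a c + dotp b c.
Proof. by rewrite /dotp -big_split; apply: eq_bigr => i _; rewrite mxE mulrDl. Qed.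

Lemma dotpZl (T : pzRingType) z (a b : 'rV[T]_d) : dotp (z *: a) b = z * dotp a b.
Proof. by rewrite /dotp mulr_sumr; apply: eq_bigr => i _; rewrite mxE mulrA. Qed.

Lemma dotpC (T : comPzRingType) (a b : 'rV[T]_d) : dotp a b = dotp b a.
Proof. by apply: eq_bigr => i _; rewrite mulrC. Qed.

Lemma dotp0 (T : pzRingType) (a : 'rV[T]_d) : dotp a 0 = 0.
Proof. by rewrite /dotp big1 // => i _; rewrite mxE mulr0. Qed.

End Dotp.

(** * Derivatives and integrals of trigonometric sums *)

Section CosineDerivative.
Variables (R : realType) (d : nat).

Lemma partial_cos_sum (m : nat) (k : 'I_m -> 'rV[R]_d) (c : 'I_m -> R) (r : 'I_d) (x : 'rV[R]_d) :
  partial r (fun y => \sum_j c j * cos (dotp (k j) y)) x =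
    - \sum_j c j * k j 0 r * sin (dotp (k j) x).
Proof.
set g := (fun t : R => \sum_j c j * cos (k j 0 r * t + dotp (k j) x)).
(* Along the line x + t delta_r the sum is the function [g] of one variable. *)
have H : is_derive (0:R) (1:R) g (- \sum_j c j * k j 0 r * sin (dotp (k j) x)).
  have -> : g = \sum_j (fun t : R => c j * cos (k j 0 r * t + dotp (k j) x)).
    by apply/funext => t; rewrite fct_sumE.
  rewrite -sumrN; apply: is_derive_sum => j.
  have D1 : is_derive (0:R) (1:R) (fun t : R => k j 0 r * t + dotp (k j) x) (k j 0 r).
    by apply: is_derive_eq; rewrite addr0 /GRing.scale /= mulr1.
  have D2 := @is_derive1_comp R cos _ 0 _ _ (is_derive_cos _) D1.
  have D3 := is_deriveZ (c j) D2.
  apply: (is_derive_eq D3).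
  by rewrite /GRing.scale /= mulr0 add0r; ring.
rewrite /partial -(@derive_val _ _ _ _ _ _ _ H) /derive.
set g1 := fun h => h^-1 *: _; set g2 := fun h => h^-1 *: _.
(* Both derivatives are limits of the same difference quotients. *)
suff -> : g1 = g2 by [].
apply/funext => h; rewrite /g1 /g2 /=.
congr (_ *: (_ - _)); rewrite /g; apply: eq_bigr => j _; last by rewrite mulr0 add0r.
congr (_ * cos _); rewrite addr0 /GRing.scale /= mulr1.
rewrite /dotp [in LHS](bigD1 r) //= [in RHS](bigD1 r) //= !mxE !eqxx mulr1 mulrDr -addrA.
congr (_ + (_ + _)); apply: eq_bigr => s sr.
by rewrite !mxE (negbTE sr) andbF mulr0 add0r.
Qed.

End CosineDerivative.

Section CircleIntegral.
Variables (R : realType).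
Implicit Types (t : R).

Lemma sin_int2pi (z : int) : sin (z%:~R * (2 * pi)) = 0 :> R.
Proof.
have H n : sin (n%:R * (2 * pi)) = 0 :> R.
  by rewrite mulr_natl [2 * pi]mulr_natl -(add0r (_ *+ n)) (periodicn (@sinD2pi R)) sin0.
case: z => n; first by rewrite -pmulrn.
by rewrite NegzE mulrNz mulNr sinN -pmulrn H oppr0.
Qed.

Lemma cos_int2pi (z : int) : cos (z%:~R * (2 * pi)) = 1 :> R.
Proof.
have H n : cos (n%:R * (2 * pi)) = 1 :> R.
  by rewrite mulr_natl [2 * pi]mulr_natl -(add0r (_ *+ n)) (periodicn (@cosD2pi R)) cos0.
case: z => n; first by rewrite -pmulrn.
by rewrite NegzE mulrNz mulNr cosN -pmulrn H.
Qed.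

Lemma is_derive_trig (a b c t : R) : is_derive t (1:R) (fun t => a * cos (c * t) + b * sin (c * t))
   (c * (b * cos (c * t) - a * sin (c * t))).
Proof.
have D1 : is_derive t (1:R) (fun t : R => c * t) c.
  by apply: is_derive_eq; rewrite /GRing.scale /=; ring.
have D2 := @is_derive1_comp R cos _ t _ _ (is_derive_cos _) D1.
have D3 := @is_derive1_comp R sin _ t _ _ (is_derive_sin _) D1.
apply: (is_derive_eq (is_deriveD (is_deriveZ a D2) (is_deriveZ b D3))).
by rewrite /GRing.scale /=; ring.
Qed.

(** Each nonconstant summand has a periodic primitive; a whole sum is integrated at once, so
that no integrability of the single summands has to be established. *)
Lemma Rintegral_trig (m : nat) (z : 'I_m -> int) (a b : 'I_m -> R) :
  Rintegral lebesgue_measure `[0, 2 * pi]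
    (fun t : R => \sum_j (a j * cos ((z j)%:~R * t) + b j * sin ((z j)%:~R * t)))
  = 2 * pi * \sum_(j | z j == 0) a j.
Proof.
set f := (fun t : R => _).
(* The primitive; its only nonperiodic terms are those of zero frequency. *)
pose F := (fun t : R => \sum_j (if z j == 0 then a j * t else
   ((z j)%:~R^-1 * - b j) * cos ((z j)%:~R * t) + ((z j)%:~R^-1 * a j) * sin ((z j)%:~R * t))).
have twopi : (0 : R) < 2 * pi by rewrite mulr_gt0 // pi_gt0.
have D t : is_derive t (1:R) F (f t).
  have -> : F = \sum_j (fun t : R => (if z j == 0 then a j * t else
   ((z j)%:~R^-1 * - b j) * cos ((z j)%:~R * t) + ((z j)%:~R^-1 * a j) * sin ((z j)%:~R * t))).
    by apply/funext => u; rewrite fct_sumE.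
  apply: is_derive_sum => j.
  have [->|z0] := eqVneq.
    by apply: is_derive_eq; rewrite !mul0r cos0 sin0 /GRing.scale /=; ring.
  have z0' : (z j)%:~R != 0 :> R by rewrite intr_eq0.
  by apply: (is_derive_eq (is_derive_trig _ _ _ _)); field.
have cf : continuous f.
  move=> t; apply/differentiable_continuous/derivable1_diffP.
  have -> : f = \sum_j (fun t : R => a j * cos ((z j)%:~R * t) + b j * sin ((z j)%:~R * t)).
    by apply/funext => u; rewrite fct_sumE.
  by apply: derivable_sum => j; apply: (@ex_derive _ _ _ _ _ _ _ (is_derive_trig _ _ _ _)).
have cF : continuous F.
  by move=> t; apply/differentiable_continuous/derivable1_diffP/(@ex_derive _ _ _ _ _ _ _ (D _)).
have ft2 := (@continuous_FTC2 _ f F 0 (2*pi) twopi).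
rewrite /Rintegral ft2; last 3 first.
- exact: continuous_subspaceT.
- split.
  + by move=> t _; apply/(@ex_derive _ _ _ _ _ _ _ (D _)).
  + by apply: cvg_at_right_filter; exact: cF.
  + by apply: cvg_at_left_filter; exact: cF.
- by move=> t _; rewrite derive1E derive_val.
rewrite -EFinB /= /F -sumrB mulr_sumr [RHS]big_mkcond /=.
apply: eq_bigr => j _; case: eqVneq => z0; first by rewrite mulr0 subr0 mulrC.
by rewrite sin_int2pi cos_int2pi !mulr0 cos0 sin0 !mulr0 !addr0 subrr.
Qed.

End CircleIntegral.

(** Orthogonality of the characters.  The class of sums a cos + b sin, unlike that of cosines
alone, is stable under freezing one variable, which is what the induction on the dimension
uses: the integral over the last d variables leaves a trigonometric sum in the first. *)
Lemma torus_int_trig (R : realType) (d m : nat) (k : 'I_m -> 'rV[int]_d) (a b : 'I_m -> R) :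
  torus_int (fun x => \sum_j (a j * cos (dotp (zvec R (k j)) x) + b j
    * sin (dotp (zvec R (k j)) x)))
  = (2 * pi) ^+ d * \sum_(j | k j == 0) a j.
Proof.
elim: d k a b => [|d IH] k a b /=.
  rewrite expr0 mul1r [RHS]big_mkcond; apply: eq_bigr => j _.
  by rewrite /dotp !big_ord0 cos0 sin0 mulr0 addr0 mulr1 [k j]thinmx0 eqxx.
pose z j := k j 0 0.
pose l j := rsubmx (k j : 'rV_(1 + d)).
have k0 j : (k j == 0) = (z j == 0) && (l j == 0).
  apply/eqP/andP => [kj0 | [/eqP zj /eqP lj]].
    by rewrite /z /l kj0 mxE; split=> //; apply/eqP/rowP => i; rewrite !mxE.
  rewrite -[k j](@hsubmxK _ 1 1 d) -/(l j) lj.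
  rewrite (_ : lsubmx _ = 0) ?row_mx0 //.
  apply/rowP => i; rewrite (ord1 i) !mxE -[RHS]zj /z; congr (k j _ _); exact/val_inj.
have E t (y : 'rV[R]_d) j : dotp (zvec R (k j)) (row_mx (const_mx t : 'rV[R]_1) y) = 
    (z j)%:~R * t + dotp (zvec R (l j)) y.
  rewrite /dotp (@big_split_ord _ _ _ 1 d) /= big_ord1 [X in _ * X]row_mxEl !mxE.
  congr ((k j _ _)%:~R * _ + _); first exact/val_inj.
  by apply: eq_bigr => i _; rewrite [X in _ * X]row_mxEr !mxE.
rewrite (_ : (fun t : R => _) = (fun t : R => (2 * pi) ^+ d * \sum_(j | l j == 0) 
   (a j * cos ((z j)%:~R * t) + b j * sin ((z j)%:~R * t)))); last first.
  apply/funext => t; rewrite -(IH l _ (fun j => b j * cos ((z j)%:~R * t) - a j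
    * sin ((z j)%:~R * t))).
  congr torus_int; apply/funext => y; apply: eq_bigr => j _.
  by rewrite E cosD sinD; ring.
rewrite (_ : (fun t : R => _) = (fun t : R => \sum_j
   (((2 * pi) ^+ d * a j *+ (l j == 0)) * cos ((z j)%:~R * t) + ((2 * pi) ^+ d * b j *+ (l j == 0))
     * sin ((z j)%:~R * t)))); last first.
  apply/funext => t; rewrite mulr_sumr [LHS]big_mkcond; apply: eq_bigr => j _.
  by case: eqP => _; rewrite ?mulr1n ?mulr0n; ring.
rewrite Rintegral_trig exprS -(mulrA (2 * pi)); congr (2 * pi * _).
rewrite mulr_sumr [LHS]big_mkcond [RHS]big_mkcond; apply: eq_bigr => j _.
by rewrite k0; case: eqP => //= _; case: eqP.
Qed.

(** * Trigonometric fields with finitely many modes *)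

Section Modes.
Variables (R : realType) (d m : nat).
Variable k : 'I_m -> 'rV[int]_d.
Hypothesis k_inj : injective k.
Hypothesis k_opp : forall i j, k i != - k j.

(** The real field with coefficient [A j] at the mode [k j]; the conjugate coefficient at
[- k j] is the reality condition. *)
Definition modeF (A : 'I_m -> 'rV[R[i]]_d) : fourier R d := fun l =>
  \sum_j ((l == k j)%:R *: A j + (l == - k j)%:R *: map_mx (@conjc R) (A j)).

Definition modes : seq 'rV[int]_d := [seq k j | j <- enum 'I_m] ++ [seq - k j | j <- enum 'I_m].

Lemma modes_uniq : uniq modes.
Proof.
rewrite cat_uniq !map_inj_uniq ?enum_uniq //; last by move=> i j /oppr_inj /k_inj.
rewrite -!enumT !enum_uniq andbT andTb; apply/hasPn => _ /mapP[j _ ->];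
  apply/negP => /mapP[i _ /eqP].
by rewrite eq_sym (negbTE (k_opp _ _)).
Qed.

Lemma zsum_modes (f : 'rV[int]_d -> R[i]) :
  (forall l, l \notin modes -> f l = 0) -> zsum f = \sum_j (f (k j) + f (- k j)).
Proof.
move=> f0; rewrite (zsum_fin modes_uniq f0) [RHS]big_split big_cat /= !big_map.
by rewrite /index_enum; case: index_enum_key.
Qed.

Lemma modeF_out A l : l \notin modes -> modeF A l = 0.
Proof.
rewrite mem_cat negb_or => /andP[l1 l2]; apply: big1 => j _.
have /negbTE-> : l != k j by apply: contra l1 => /eqP->; apply/mapP; exists j; rewrite ?mem_enum.
have /negbTE-> : l != - k j by apply: contra l2 => /eqP->; apply/mapP; exists j; rewrite ?mem_enum.
by rewrite !scale0r addr0.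
Qed.

Lemma modeF_pos A j : modeF A (k j) = A j.
Proof.
rewrite /modeF (bigD1 j) //= eqxx scale1r (negbTE (k_opp _ _)) scale0r addr0 big1 ?addr0 // => i ij.
by rewrite (inj_eq k_inj) eq_sym (negbTE ij) (negbTE (k_opp _ _)) !scale0r addr0.
Qed.

Lemma modeF_neg A j : modeF A (- k j) = map_mx (@conjc R) (A j).
Proof.
have E i : - k j == k i = false by rewrite eq_sym (negbTE (k_opp _ _)).
rewrite /modeF (bigD1 j) //= eqxx scale1r E scale0r add0r big1 ?addr0 // => i ij.
by rewrite E (inj_eq oppr_inj) (inj_eq k_inj) eq_sym (negbTE ij) !scale0r addr0.
Qed.

Lemma k_neq0 j : k j != 0.
Proof.
by apply/negP => /eqP kj; have := k_opp j j; rewrite kj oppr0 eqxx.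
Qed.

(** The modes [k j] and [- k j] together give twice the real part of A e^(ik.x). *)
Lemma field_modeF A x :
  field (modeF A) x = \row_s (2 * (2 * pi) `^ (- (d%:R / 2)) *
    \sum_j (complex.Re (A j 0 s) * cos (dotp (zvec R (k j)) x)
           - complex.Im (A j 0 s) * sin (dotp (zvec R (k j)) x))).
Proof.
apply/rowP => s; rewrite !mxE zsum_modes; last by move=> l lm; rewrite modeF_out // mxE mul0r.
rewrite raddf_sum mulr_sumr; apply: eq_bigr => j _.
rewrite modeF_pos modeF_neg mxE /ek zvecN dotpN cosN sinN.
case: (A j 0 s) => u v /=; ring.
Qed.

End Modes.

Definition toC (R : realType) (d : nat) (a : 'rV[R]_d) : 'rV[R[i]]_d := map_mx (real_complex R) a.

Section Lengths.
Variables (R : realType) (d : nat).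

Definition znormsq (l : 'rV[int]_d) : R := dotp (zvec R l) (zvec R l).

Definition cnormsq (A : 'rV[R[i]]_d) : R := complex.Re (dotp (map_mx (@conjc R) A) A).

Lemma zvecC (l : 'rV[int]_d) : zvec R[i] l = toC (zvec R l).
Proof. by apply/rowP => i; rewrite !mxE rmorph_int. Qed.

Lemma conj_toC (a : 'rV[R]_d) : map_mx (@conjc R) (toC a) = toC a.
Proof. by apply/rowP => i; rewrite !mxE /= oppr0. Qed.

Lemma dotp_toC (a b : 'rV[R]_d) : dotp (toC a) (toC b) = real_complex R (dotp a b).
Proof.
by rewrite /dotp rmorph_sum; apply: eq_bigr => i _; rewrite !mxE -rmorphM.
Qed.

Lemma dotp_conjE (A : 'rV[R[i]]_d) : dotp (map_mx (@conjc R) A) A =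
  real_complex R (\sum_r (complex.Re (A 0 r) ^+ 2 + complex.Im (A 0 r) ^+ 2)).
Proof.
rewrite /dotp rmorph_sum; apply: eq_bigr => i _; rewrite !mxE.
case: (A 0 i) => x y /=; apply/eqP; rewrite eq_complex /=; apply/andP; split; apply/eqP; ring.
Qed.

Lemma cnormsqE A : real_complex R (cnormsq A) = dotp (map_mx (@conjc R) A) A.
Proof. by rewrite /cnormsq dotp_conjE. Qed.

Lemma cnormsq_ge0 A : 0 <= cnormsq A.
Proof. by rewrite /cnormsq dotp_conjE; apply: sumr_ge0 => i _; rewrite addr_ge0 // sqr_ge0. Qed.

Lemma cnorm_sqr A : cnorm A ^+ 2 = cnormsq A.
Proof. by rewrite sqr_sqrtr // cnormsq_ge0. Qed.

Lemma cnormsq_conj A : cnormsq (map_mx (@conjc R) A) = cnormsq A.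
Proof.
rewrite /cnormsq !dotp_conjE /=; apply: eq_bigr => i _; rewrite !mxE.
by case: (A 0 i) => x y /=; rewrite sqrrN.
Qed.

Lemma cnormsq_toC z (a : 'rV[R]_d) : cnormsq (z *: toC a) =
  (complex.Re z ^+ 2 + complex.Im z ^+ 2) * dotp a a.
Proof.
rewrite /cnormsq dotp_conjE /= mulr_sumr; apply: eq_bigr => i _; rewrite !mxE.
by case: z => x y /=; ring.
Qed.

Lemma znorm_powR l s : znorm R l `^ (2 * s) = znormsq l `^ s.
Proof.
rewrite powRrM powR_mulrn ?sqrtr_ge0 // /znorm cnorm_sqr zvecC.
by rewrite -[toC _]scale1r cnormsq_toC /= expr1n expr0n addr0 mul1r.
Qed.

Lemma znormsqN l : znormsq (- l) = znormsq l.
Proof.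
by apply: eq_bigr => i _; rewrite !mxE rmorphN mulrNN.
Qed.

Lemma dotp_conj (A B : 'rV[R[i]]_d) : dotp (map_mx (@conjc R) A) (map_mx (@conjc R) B) =
  conjc (dotp A B).
Proof. by rewrite [RHS]rmorph_sum; apply: eq_bigr => i _; rewrite !mxE -rmorphM. Qed.

End Lengths.

Section TrigFieldNorms.
Variables (R : realType) (d m : nat).
Variable k : 'I_m -> 'rV[int]_d.
Hypothesis k_inj : injective k.
Hypothesis k_opp : forall i j, k i != - k j.
Implicit Type A : 'I_m -> 'rV[R[i]]_d.

Lemma Hinner_modeF s A :
  Hinner s (modeF k A) (modeF k A) =
    real_complex R (2 * \sum_j znormsq R (k j) `^ s * cnormsq (A j)).
Proof.
rewrite /Hinner (zsum_modes k_inj k_opp); last first.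
  by move=> l lm; rewrite (modeF_out _ lm) dotp0 mulr0 if_same.
rewrite rmorphM rmorph_sum mulr_sumr; apply: eq_bigr => j _.
rewrite oppr_eq0 (negbTE (k_neq0 k_opp j)) !znorm_powR znormsqN modeF_pos // modeF_neg //.
by rewrite -!cnormsqE cnormsq_conj -!rmorphM -rmorphD; apply: (congr1 (real_complex R)); ring.
Qed.

Lemma Hnorm_modeF s A : Hnorm s (modeF k A) =
  Num.sqrt (2 * \sum_j znormsq R (k j) `^ s * cnormsq (A j)).
Proof. by rewrite /Hnorm Hinner_modeF. Qed.

Lemma modeF_Hspace s A : (forall j, dotp (zvec R[i] (k j)) (A j) = 0) -> Hspace s (modeF k A).
Proof.
move=> kA; split.
- move=> l; apply/rowP => r; rewrite !mxE !summxE rmorph_sum; apply: eq_bigr => j _.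
  rewrite !mxE !eqr_oppLR opprK addrC !rmorphD !rmorphM !rmorph_nat.
  by rewrite /= conjcK.
- move=> l; case lm : (l \in modes k); last by rewrite modeF_out ?lm // dotp0.
  move: lm; rewrite mem_cat => /orP[] /mapP[j _ ->].
    by rewrite modeF_pos.
  rewrite modeF_neg // zvecN dotpN zvecC -conj_toC dotp_conj -zvecC kA.
  by rewrite rmorph0 oppr0.
- by rewrite modeF_out // mem_cat; apply/norP; split; apply/mapP => -[j _ /eqP];
    rewrite eq_sym ?oppr_eq0 (negbTE (k_neq0 k_opp j)).
- rewrite (_ : (\esum_(_ in _) _)%E = (\esum_(l in [set` modes k])
     (znorm R l `^ (2 * s) * cnorm (modeF k A l) ^+ 2)%:E)%E); last first.
    rewrite esum_mkcond [RHS]esum_mkcond; apply: eq_esum => l _.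
    case: (boolP (l \in modes k)) => lm.
      rewrite [X in _ = if X then _ else _]mem_set // mem_set //=.
      by move: lm; rewrite mem_cat => /orP[] /mapP[j _ ->]; rewrite ?oppr_eq0 (k_neq0 k_opp j).
    rewrite [X in _ = if X then _ else _]memNset; last exact/negP.
    by rewrite modeF_out // /cnorm dotp0 sqrtr0 expr0n mulr0 if_same.
  rewrite esum_fset //; last first.
    by move=> l _; rewrite lee_fin mulr_ge0 // ?powR_ge0 // sqr_ge0.
    exact: finite_seq.
by rewrite fsumEFin ?ltry //; exact: finite_seq.
Qed.

(** The projection removes multiples of [k], which are orthogonal to a divergence-free field.
The coefficients of [F] are taken real and even, as is the case for a cosine series. *)
Lemma Hinner_leray s (F : fourier R d) (f a : 'I_m -> 'rV[R]_d) :
  (forall j, dotp (zvec R (k j)) (a j) = 0) ->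
  (forall j, F (k j) = toC (f j)) -> (forall j, F (- k j) = toC (f j)) ->
  Hinner s (leray F) (modeF k (fun j => toC (a j))) =
    real_complex R (2 * \sum_j znormsq R (k j) `^ s * dotp (f j) (a j)).
Proof.
move=> ka F1 F2.
have L l (b g : 'rV[R]_d) : dotp (zvec R l) b = 0 -> l != 0 -> F l = toC g ->
    dotp (map_mx (@conjc R) (leray F l)) (toC b) = real_complex R (dotp g b).
  move=> lb l0 Fl; rewrite /leray (negbTE l0) Fl map_mxB map_mxZ dotpDl dotpN dotpZl.
  by rewrite zvecC !conj_toC !dotp_toC lb mulr0 subr0.
rewrite /Hinner (zsum_modes k_inj k_opp); last first.
  by move=> l lm; rewrite (modeF_out _ lm) dotp0 mulr0 if_same.
rewrite rmorphM rmorph_sum mulr_sumr; apply: eq_bigr => j _.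
rewrite oppr_eq0 (negbTE (k_neq0 k_opp j)) !znorm_powR znormsqN modeF_pos // modeF_neg //= conj_toC.
have kN : dotp (zvec R (- k j)) (a j) = 0 by rewrite zvecN dotpN ka oppr0.
have kN0 : - k j != 0 by rewrite oppr_eq0 k_neq0.
have L1 := L (k j) (a j) (f j) (ka j) (k_neq0 k_opp j) (F1 j).
have L2 := L (- k j) (a j) (f j) kN kN0 (F2 j).
apply: etrans (congr2 +%R (congr1 ( *%R _) L1) (congr1 ( *%R _) L2)) _.
by rewrite -!rmorphM -rmorphD; apply: (congr1 (real_complex R)); ring.
Qed.

End TrigFieldNorms.

(** * Fourier coefficients of a cosine series *)

Lemma torus_int_trig_fin (R : realType) (d : nat) (J : finType)
    (k : J -> 'rV[int]_d) (a b : J -> R) :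
  torus_int (fun x => \sum_j (a j * cos (dotp (zvec R (k j)) x) + b j
    * sin (dotp (zvec R (k j)) x)))
  = (2 * pi) ^+ d * \sum_(j | k j == 0) a j.
Proof.
have E (F : J -> R) : \sum_j F j = \sum_(i < #|J|) F (enum_val i).
  rewrite (reindex (@enum_val J predT)); last exact/onW_bij/enum_val_bij.
  by apply: eq_bigl.
rewrite [in RHS]big_mkcond E -big_mkcond /= -(torus_int_trig _ _ (fun i => b (enum_val i))).
by congr torus_int; apply/funext => x; rewrite E.
Qed.

Lemma sum_prod_bool (J : finType) (V : nmodType) (F : J * bool -> V) :
  \sum_i F i = \sum_j (F (j, true) + F (j, false)).
Proof.
rewrite (eq_bigr (fun p => F (p.1, p.2))); last by case.
rewrite -(pair_bigA _ (fun j b => F (j, b))) /=.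
by apply: eq_bigr => j _; rewrite big_bool.
Qed.

Section FourierCoefficient.
Variables (R : realType) (d : nat).
Local Notation c := ((2 * pi : R) `^ (- (d%:R / 2))).

Lemma fourier_coef_cos (J : finType) (mu : J -> 'rV[int]_d) (C : J -> 'rV[R]_d)
    (g : 'rV[R]_d -> 'rV[R]_d) l :
  (forall x, g x = \sum_j cos (dotp (zvec R (mu j)) x) *: C j) ->
  fourier_coef g l = toC ((c * (2 * pi) ^+ d / 2) *: \sum_j ((mu j == - l)%:R + (mu j == l)%:R)
    *: C j).
Proof.
move=> gE; apply/rowP => s; rewrite !mxE summxE.
pose k (i : J * bool) := if i.2 then mu i.1 + l else mu i.1 - l.
have ekE x : conjc (ek l x) = Complex (c
  * cos (dotp (zvec R l) x)) (- (c * sin (dotp (zvec R l) x))).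
  by rewrite /ek /=; apply/eqP; rewrite eq_complex /=; apply/andP; split; apply/eqP; ring.
congr Complex.
  rewrite (_ : (fun x => _) = (fun x => \sum_i ((c / 2 * C i.1 0 s) * cos (dotp (zvec R (k i)) x)
      + 0 * sin (dotp (zvec R (k i)) x)))); last first.
    apply/funext => x; rewrite ekE gE summxE mulr_suml [RHS]sum_prod_bool; apply: eq_bigr => j _.
    by rewrite mxE /k /= !zvecD zvecN !dotpDl dotpN !cosD cosN sinN; field.
  rewrite torus_int_trig_fin [in LHS]big_mkcond sum_prod_bool /= !mulr_sumr; apply: eq_bigr => j _.
  rewrite mxE /k /= subr_eq0 addr_eq0.
  by do 2!case: eqP => _ /=; field.
rewrite (_ : (fun x => _) = (fun x => \sum_i (0 * cos (dotp (zvec R (k i)) x)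
      + ((if i.2 then -1 else 1) * (c / 2 * C i.1 0 s)) * sin (dotp (zvec R (k i)) x))));
        last first.
  apply/funext => x; rewrite ekE gE summxE mulr_suml [RHS]sum_prod_bool; apply: eq_bigr => j _.
  by rewrite mxE /k /= !zvecD zvecN !dotpDl dotpN !sinD cosN sinN; field.
by rewrite torus_int_trig_fin big1 ?mulr0.
Qed.

(** The normalization of the basis cancels the volume of the torus. *)
Lemma ek_const_sq : c * c * (2 * pi) ^+ d = 1.
Proof.
have tp : 0 < (2 * pi : R) by rewrite mulr_gt0 // pi_gt0.
have tp0 (b : bool) : b ==> (2 * pi != 0 :> R) by rewrite gt_eqF ?implybT.
rewrite -powRD // -[(2 * pi) ^+ d]powR_mulrn ?ltW // -powRD //.
by rewrite (_ : _ + _ = 0) ?powRr0 //; field.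
Qed.

End FourierCoefficient.

(** * The nonlinear term for a shear flow and a cosine series *)

Section Shear.
Variables (R : realType) (d m : nat).
Local Notation c := ((2 * pi : R) `^ (- (d%:R / 2))).
Variable k : 'I_m -> 'rV[int]_d.
Hypothesis k_inj : injective k.
Hypothesis k_opp : forall i j, k i != - k j.
Variable a : 'I_m -> 'rV[R]_d.
Hypothesis ka : forall j, dotp (zvec R (k j)) (a j) = 0.
Variable h : 'rV[int]_d.
Hypothesis h_neq0 : h != 0.
Variable b : 'rV[R]_d.
Hypothesis hb : dotp (zvec R h) b = 0.

(* The coefficient -i b at h makes v a sine series. *)
Let v := modeF (fun _ : 'I_1 => h) (fun _ => (Complex 0 (-1)) *: toC b).
Let w := modeF k (fun j => toC (a j)).

Let h_inj : injective (fun _ : 'I_1 => h).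
Proof. by move=> i j _; rewrite (ord1 i) (ord1 j). Qed.
Let h_opp : forall i j : 'I_1, h != - h.
Proof.
move=> _ _; apply: contra h_neq0 => /eqP/rowP hE; apply/eqP/rowP => r; have := hE r.
rewrite !mxE => /eqP; rewrite -subr_eq0 opprK => /eqP e.
by apply/eqP; move/eqP: e; rewrite -mulr2n mulrn_eq0.
Qed.

Lemma field_shear x : field v x = (2 * c * sin (dotp (zvec R h) x)) *: b.
Proof.
apply/rowP => s; rewrite (field_modeF h_inj h_opp) !mxE big_ord1 /= ?mxE; ring.
Qed.

Lemma field_cosines x : field w x = \row_s \sum_j (2 * c * a j 0 s) * cos (dotp (zvec R (k j)) x).
Proof.
apply/rowP => s; rewrite (field_modeF k_inj k_opp) !mxE mulr_sumr; apply: eq_bigr => j _.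
by rewrite !mxE /=; ring.
Qed.

(* The product of a sine and a sine is a difference of two cosines: every mode k i is
   shifted by h in both directions. *)
Let mu (i : 'I_m * bool) := if i.2 then k i.1 + h else k i.1 - h.
Let C (i : 'I_m * bool) : 'rV[R]_d :=
  ((if i.2 then 1 else -1) * (2 * c * c * dotp b (zvec R (k i.1)))) *: a i.1.

Lemma advect_shear x : advect (field v) (field w) x = \sum_i cos (dotp (zvec R (mu i)) x) *: C i.
Proof.
apply/rowP => s; rewrite mxE summxE sum_prod_bool.
transitivity (\sum_(r < d) \sum_j - (2 * c * sin (dotp (zvec R h) x) * (2 * c * a j 0 s)
  * sin (dotp (zvec R (k j)) x)) * (b 0 r * zvec R (k j) 0 r)).
  apply: eq_bigr => r _.
  rewrite (_ : (fun y => _) = (fun y => \sum_j (2 * c * a j 0 s) * cos (dotp (zvec R (k j)) y)));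
    last first.
    by apply/funext => y; rewrite field_cosines mxE.
  rewrite partial_cos_sum field_shear mxE mulrN mulr_sumr -sumrN; apply: eq_bigr => j _.
  by ring.
rewrite exchange_big /=; apply: eq_bigr => j _.
rewrite -mulr_sumr -/(dotp _ _) !mxE /mu /= !zvecD zvecN !dotpDl dotpN !cosD cosN sinN.
by ring.
Qed.

(** The four indicators say when a shift of the mode [k i] by [h] meets one of the two modes
plus or minus [k j] of the second factor. *)
Lemma Hinner_shear s : Hinner s (calP v w) w =
  real_complex R (2 * c * \sum_j \sum_i znormsq R (k j) `^ s * (dotp b (zvec R (k i)) *
     ((k i + h == - k j)%:R + (k i + h == k j)%:R - (k i - h == - k j)%:R - (k i - h == k j)%:R)
       * dotp (a i) (a j))).
Proof.
pose f l := (c * (2 * pi) ^+ d / 2) *: \sum_i ((mu i == - l)%:R + (mu i == l)%:R) *: C i.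
have F l : fourier_coef (advect (field v) (field w)) l = toC (f l).
  exact/fourier_coef_cos/advect_shear.
have fN l : f (- l) = f l.
  by congr (_ *: _); apply: eq_bigr => i _; rewrite opprK addrC.
rewrite /calP (Hinner_leray k_inj k_opp s (f := fun j => f (k j)) ka) //; last by move=> j;
  rewrite F fN.
apply: (congr1 (real_complex R)); rewrite -mulrA; congr (2 * _); rewrite mulr_sumr;
  apply: eq_bigr => j _.
rewrite dotpZl.
have D (u : 'I_m * bool -> 'rV[R]_d) (z : 'rV[R]_d) : dotp (\sum_i u i) z = \sum_i dotp (u i) z.
  by rewrite /dotp exchange_big; apply: eq_bigr => r _; rewrite summxE mulr_suml.
rewrite D sum_prod_bool !mulr_sumr; apply: eq_bigr => i _.
rewrite !dotpZl /mu /=.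
transitivity (c * (c * c * (2 * pi) ^+ d) * (znormsq R (k j) `^ s * (dotp b (zvec R (k i)) *
     ((k i + h == - k j)%:R + (k i + h == k j)%:R - (k i - h == - k j)%:R - (k i - h == k j)%:R)
       * dotp (a i) (a j)))); last by rewrite ek_const_sq mulr1.
by field.
Qed.

(** Evaluates the inequality at v and w.  The modes at plus and minus the same wave vector
contribute equally to a norm, whence the factors 2 under the square roots. *)
Lemma kato_shear (p n G : R) : kato_bound d p n G ->
  2 * c * \sum_j \sum_i znormsq R (k j) `^ p * (dotp b (zvec R (k i)) *
     ((k i + h == - k j)%:R + (k i + h == k j)%:R - (k i - h == - k j)%:R - (k i - h == k j)%:R)
       * dotp (a i) (a j)) <=
  2^-1 * G * (Num.sqrt (2 * (znormsq R h `^ p * dotp b b))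
    * Num.sqrt (2 * \sum_j znormsq R (k j) `^ n * dotp (a j) (a j))
            + Num.sqrt (2 * (znormsq R h `^ n * dotp b b))
              * Num.sqrt (2 * \sum_j znormsq R (k j) `^ p * dotp (a j) (a j)))
         * Num.sqrt (2 * \sum_j znormsq R (k j) `^ p * dotp (a j) (a j)).
Proof.
move=> K0; have K := K0 v w.
have vH : Hspace p v.
  apply: (modeF_Hspace h_inj h_opp) => _.
  by rewrite dotpC dotpZl zvecC dotp_toC dotpC hb rmorph0 mulr0.
have wH : Hspace (p + 1) w.
  by apply: (modeF_Hspace k_inj k_opp) => j; rewrite zvecC dotp_toC ka rmorph0.
have {K} := K vH wH.
have Hv s : Hnorm s v = Num.sqrt (2 * (znormsq R h `^ s * dotp b b)).
  by rewrite (Hnorm_modeF h_inj h_opp) big_ord1 cnormsq_toC /= expr0n add0r sqrrN expr1n mul1r.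
have Hw s : Hnorm s w = Num.sqrt (2 * \sum_j znormsq R (k j) `^ s * dotp (a j) (a j)).
  rewrite (Hnorm_modeF k_inj k_opp); congr (Num.sqrt (2 * _)); apply: eq_bigr => j _.
  by rewrite -[toC _]scale1r cnormsq_toC /= expr0n expr1n addr0 mul1r.
rewrite !Hv !Hw Hinner_shear; apply: le_trans.
by rewrite normc_def /= expr0n addr0 sqrtr_sqr ler_norm.
Qed.

End Shear.

(** * A chain of five modes *)

Section Chain.
Variables (R : realType) (d : nat).
Variables (e0 e1 : 'I_d).
Hypothesis e01 : e0 != e1.
Variable N : nat.
Hypothesis N_gt0 : (0 < N)%N.

(** The wave vectors (j N, 1, 0, ..) for -2 <= j <= 2; the index is shifted by 2 to start
from 0.  The constant component 1 keeps a mode from meeting the opposite of another one. *)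
Definition chain (j : 'I_5) : 'rV[int]_d :=
  \row_r (if r == e0 then (j%:Z - 2) * N%:Z else (r == e1)%:Z).

Definition step : 'rV[int]_d := \row_r (if r == e0 then N%:Z else 0).
Let b : 'rV[R]_d := delta_mx 0 e1.

Lemma sum_e01 (F : 'I_d -> R) : (forall r, r != e0 -> r != e1 -> F r = 0) ->
  \sum_r F r = F e0 + F e1.
Proof.
move=> F0; rewrite (bigD1 e0) //= (bigD1 e1) /=; last by rewrite eq_sym.
by rewrite big1 ?addr0 // => r /andP[r0 r1]; exact: F0.
Qed.

Lemma znormsq_chain j : znormsq R (chain j) = ((j%:R - 2) * N%:R) ^+ 2 + 1.
Proof.
rewrite /znormsq /dotp sum_e01; last by move=> r r0 r1; rewrite !mxE (negbTE r0) (negbTE r1) mulr0.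
rewrite !mxE !eqxx eq_sym (negbTE e01) mulr1 expr2.
by congr (_ * _ + _); rewrite rmorphM rmorphB.
Qed.

Lemma znormsq_step : znormsq R step = N%:R ^+ 2.
Proof.
rewrite /znormsq /dotp sum_e01; last by move=> r r0 r1; rewrite !mxE (negbTE r0) mulr0.
by rewrite !mxE !eqxx eq_sym (negbTE e01) mulr0 addr0 expr2.
Qed.

Lemma dotp_delta (a : 'rV[R]_d) r : dotp (delta_mx 0 r) a = a 0 r.
Proof.
rewrite /dotp (bigD1 r) //= !mxE !eqxx mul1r big1 ?addr0 // => s sr.
by rewrite mxE (negbTE sr) andbF mul0r.
Qed.

Lemma chain_e1 j : chain j 0 e1 = 1.
Proof. by rewrite mxE eq_sym (negbTE e01) eqxx. Qed.

Lemma chain_e0 j : chain j 0 e0 = (j%:Z - 2) * N%:Z.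
Proof. by rewrite mxE eqxx. Qed.

Lemma chain_step i j : (chain i + step == chain j) = (j == i.+1 :> nat).
Proof.
apply/eqP/eqP => [/rowP/(_ e0)|ij].
  rewrite mxE !chain_e0 mxE eqxx => E.
  have /eqP : (i%:Z - 2 + 1 - (j%:Z - 2)) * N%:Z = 0.
    by rewrite mulrBl mulrDl mul1r E subrr.
  rewrite mulf_eq0 => /orP[/eqP H|/eqP H]; last by case: H N_gt0 => ->.
  lia.
apply/rowP => r; rewrite !mxE ij; case: eqP => _; last by rewrite addr0.
by rewrite intS; ring.
Qed.

Lemma chain_stepN i j : (chain i - step == chain j) = (i == j.+1 :> nat).
Proof. by rewrite subr_eq eq_sym chain_step. Qed.

Lemma chain_inj : injective chain.
Proof.
move=> i j /rowP/(_ e0); rewrite !chain_e0 => E.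
have /eqP : (i%:Z - j%:Z) * N%:Z = 0.
  by apply/eqP; rewrite -(subrr (chain j 0 e0)) chain_e0 -{1}E; apply/eqP; ring.
rewrite mulf_eq0 => /orP[|/eqP H]; last by case: H N_gt0 => ->.
by rewrite subr_eq0 => /eqP [] /val_inj.
Qed.

Lemma chain_opp i j : chain i != - chain j.
Proof. by apply/eqP => /rowP/(_ e1); rewrite [RHS]mxE !chain_e1. Qed.

Lemma chain_step_opp i j : (chain i + step == - chain j) = false.
Proof. by apply/eqP => /rowP/(_ e1); rewrite !mxE eq_sym (negbTE e01) eqxx. Qed.

Lemma chain_stepN_opp i j : (chain i - step == - chain j) = false.
Proof. by apply/eqP => /rowP/(_ e1); rewrite !mxE eq_sym (negbTE e01) eqxx. Qed.

(** A quarter of the square of the norm of w of order [s], when the outermost amplitudes have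
square [ga] and the other ones are unit. *)
Definition chain_sum (ga s : R) := ga * (4 * N%:R ^+ 2 + 1) `^ s + (N%:R ^+ 2 + 1) `^ s + 2^-1.

(** The combination of norms on the right-hand side of the inequality, up to a constant
factor. *)
Definition chain_den (ga p n : R) :=
  (N%:R `^ p * Num.sqrt (chain_sum ga n) + N%:R `^ n * Num.sqrt (chain_sum ga p))
  * Num.sqrt (chain_sum ga p).

(** Only neighbours in the chain interact, and the two orders (i, i + 1) and (i + 1, i) of a
link carry opposite signs, so a link contributes its scalar product times the increment of
|k|^(2p).  Since this increment is negative on the first half of the chain, the scalar
products are required to change sign in the middle. *)
Lemma kato_chain (p n G al be ga : R) (a : 'I_5 -> 'rV[R]_d) :
  (forall j, dotp (zvec R (chain j)) (a j) = 0) ->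
  (forall j, dotp (a j) (a j) = nth 0 [:: ga; 1; 1; 1; ga] j) ->
  (forall i j : 'I_5, j = i.+1 :> nat -> dotp (a i) (a j) = nth 0 [:: - be; - al; al; be] i) ->
  kato_bound d p n G ->
  Num.sqrt 2 * (2 * pi) `^ (- (d%:R / 2)) *
   (be * ((4 * N%:R ^+ 2 + 1) `^ p - (N%:R ^+ 2 + 1) `^ p) + al * ((N%:R ^+ 2 + 1) `^ p - 1)) <=
  G * chain_den ga p n.
Proof.
rewrite /chain_den => ka aa aj K.
have step0 : step != 0.
  by apply/eqP => /rowP/(_ e0); rewrite !mxE eqxx => -[E]; move: N_gt0; rewrite E.
have hb : dotp (zvec R step) b = 0.
  by rewrite dotpC dotp_delta !mxE eq_sym (negbTE e01).
have := kato_shear chain_inj chain_opp ka step0 hb K.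
have bb : dotp b b = 1 by rewrite dotp_delta mxE !eqxx.
pose K2 : R := 4 * N%:R ^+ 2 + 1.
pose K1 : R := N%:R ^+ 2 + 1.
have Z j : znormsq R (chain j) = nth 0 [:: K2; K1; 1; K1; K2] j.
  rewrite znormsq_chain /K1 /K2; case: j => -[|[|[|[|[|]]]]] //= _; ring.
have W s : \sum_j znormsq R (chain j) `^ s * dotp (a j) (a j) = 2 * chain_sum ga s.
  rewrite !big_ord_recl big_ord0 !aa !Z /= /chain_sum -/K1 -/K2.
  by rewrite powR1; field.
have bk i : dotp b (zvec R (chain i)) = 1 by rewrite dotp_delta mxE chain_e1.
have -> : \sum_j \sum_i znormsq R (chain j) `^ p * (dotp b (zvec R (chain i)) *
     ((chain i + step == - chain j)%:R + (chain i + step == chain j)%:R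
      - (chain i - step == - chain j)%:R - (chain i - step == chain j)%:R)
       * dotp (a i) (a j)) = 2 * (be * (K2 `^ p - K1 `^ p) + al * (K1 `^ p - 1)).
  transitivity (\sum_(j < 5) \sum_(i < 5) (nth 0 [:: K2; K1; 1; K1; K2] j) `^ p *
      (if j == i.+1 :> nat then nth 0 [:: - be; - al; al; be] i
       else if i == j.+1 :> nat then - nth 0 [:: - be; - al; al; be] j else 0)).
    apply: eq_bigr => j _; apply: eq_bigr => i _.
    rewrite Z bk chain_step_opp chain_stepN_opp chain_step chain_stepN; congr (_ * _).
    case: eqP => ij; case: eqP => ji; try by exfalso; lia.
    - by rewrite add0r subr0 subr0 !mul1r aj.
    - by rewrite addr0 subr0 sub0r mul1r mulN1r dotpC aj.
    - by rewrite addr0 !subr0 mulr0 mul0r.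
  rewrite !big_ord_recl !big_ord0 /=.
  by rewrite powR1; ring.
have N0 : 0 <= N%:R :> R by exact: ler0n.
have st s : Num.sqrt (znormsq R step `^ s) = N%:R `^ s.
  rewrite znormsq_step -powR_mulrn // -powRrM mulrC powRrM powR_mulrn ?powR_ge0 //.
  by rewrite sqrtr_sqr ger0_norm // powR_ge0.
have s4 (x : R) : Num.sqrt (2 * (2 * x)) = 2 * Num.sqrt x.
  by rewrite mulrA sqrtrM // -expr2 sqrtr_sqr ger0_norm.
rewrite !W bb !mulr1 !s4 !(@sqrtrM _ 2) // !st.
set c := _ `^ (- _); set X := be * _ + _.
set A := N%:R `^ p; set B := N%:R `^ n; set C := Num.sqrt (chain_sum _ _);
  set D := Num.sqrt (chain_sum _ _).
move=> H; rewrite -(@ler_pM2l _ (2 * Num.sqrt 2)); last by rewrite mulr_gt0 // sqrtr_gt0.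
have s2 : Num.sqrt 2 * Num.sqrt 2 = 2 :> R by rewrite -expr2 sqr_sqrtr.
have -> : 2 * Num.sqrt 2 * (Num.sqrt 2 * c * X) = 2 * c * (2 * X).
  by transitivity (2 * (Num.sqrt 2 * Num.sqrt 2) * c * X); [ring|rewrite s2; ring].
apply: le_trans H _; rewrite le_eqVlt; apply/orP; left; apply/eqP; by field.
Qed.

End Chain.

Section Polarizations.
Variables (R : realType) (d : nat) (e0 e1 : 'I_d).
Hypothesis e01 : e0 != e1.
Variable N : nat.
Hypothesis N_gt0 : (0 < N)%N.
Local Notation T := (N%:R ^+ 2 : R).

(** A polarization along a third axis is orthogonal to all wave vectors of the chain, so the
scalar products along the links are those of the amplitudes. *)
Lemma kato_chain_transverse (e2 : 'I_d) (p n G : R) : e2 != e0 -> e2 != e1 -> kato_bound d p n G ->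
  Num.sqrt 2 * (2 * pi) `^ (- (d%:R / 2)) *
   ((2 `^ p)^-1 * ((4 * T + 1) `^ p - (T + 1) `^ p) + ((T + 1) `^ p - 1)) <=
  G * chain_den N ((2 `^ p)^-1 ^+ 2) p n.
Proof.
move=> e20 e21 K.
pose c2 : R := (2 `^ p)^-1.
pose a (j : 'I_5) : 'rV[R]_d := nth 0 [:: c2; -1; 1; 1; c2] j *: delta_mx 0 e2.
have aa i j : dotp (a i) (a j) = nth 0 [:: c2; -1; 1; 1; c2] i * nth 0 [:: c2; -1; 1; 1; c2] j.
  by rewrite dotpZl dotp_delta !mxE !eqxx mulr1.
have H := fun h1 h2 h3 => @kato_chain R d e0 e1 e01 N N_gt0 p n G 1 c2 (c2 ^+ 2) a h1 h2 h3 K.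
rewrite mul1r in H; apply: H.
- by move=> j; rewrite dotpC dotpZl dotp_delta !mxE (negbTE e20) (negbTE e21) mulr0.
- by move=> j; rewrite aa; case: j => -[|[|[|[|[|]]]]] //= _; ring.
- by move=> i j ij; rewrite aa ij; case: i {ij} => -[|[|[|[|[|]]]]] //= _; ring.
Qed.

(** In the plane of the chain the polarization at (j N, 1) is the unit vector along (-1, j N).
Its scalar products with its neighbours are (1 + 2 N^2) / (|k_1| |k_2|) on the outer links
and 1 / |k_1| on the inner ones. *)
Lemma kato_chain_planar (p n G : R) : kato_bound d p n G ->
  Num.sqrt 2 * (2 * pi) `^ (- (d%:R / 2)) *
   ((2 `^ p)^-1 * (1 + 2 * T) / (Num.sqrt (T + 1) * Num.sqrt (4 * T + 1))
     * ((4 * T + 1) `^ p - (T + 1) `^ p)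
      + (Num.sqrt (T + 1))^-1 * ((T + 1) `^ p - 1)) <=
  G * chain_den N ((2 `^ p)^-1 ^+ 2) p n.
Proof.
move=> K.
pose c2 : R := (2 `^ p)^-1.
pose s := Num.sqrt (T + 1); pose t := Num.sqrt (4 * T + 1).
have T0 : 0 <= T by exact: sqr_ge0.
have s0 : s != 0 by rewrite gt_eqF // sqrtr_gt0; lra.
have t0 : t != 0 by rewrite gt_eqF // sqrtr_gt0; lra.
have ss : s ^+ 2 = T + 1 by rewrite sqr_sqrtr //; lra.
have tt : t ^+ 2 = 4 * T + 1 by rewrite sqr_sqrtr //; lra.
pose g (j : 'I_5) : R := nth 0 [:: c2 / t; - s^-1; 1; s^-1; c2 / t] j.
pose a (j : 'I_5) : 'rV[R]_d := \row_r (g j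
  * (if r == e0 then -1 else if r == e1 then (j%:R - 2) * N%:R else 0)).
have aa i j : dotp (a i) (a j) = g i * g j * (1 + (i%:R - 2) * (j%:R - 2) * T).
  rewrite /dotp (sum_e01 e01); last by move=> r r0 r1; rewrite !mxE (negbTE r0) (negbTE r1) !mulr0.
  by rewrite !mxE !eqxx eq_sym (negbTE e01); ring.
have H := fun h1 h2 h3 => @kato_chain R d e0 e1 e01 N N_gt0 p n G s^-1
  (c2 * (1 + 2 * T) / (s * t)) (c2 ^+ 2) a h1 h2 h3 K.
apply: H.
- move=> j; rewrite /dotp (sum_e01 e01); last by move=> r r0 r1;
    rewrite !mxE (negbTE r0) (negbTE r1) mul0r.
  by rewrite !mxE !eqxx eq_sym (negbTE e01) rmorphM rmorphB /=; ring.
- move=> j; rewrite aa /g; case: j => -[|[|[|[|[|]]]]] //= _.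
  + transitivity (c2 ^+ 2 / t ^+ 2 * (4 * T + 1)); first by field.
    by rewrite -tt; field.
  + transitivity (s ^- 2 * (T + 1)); first by field.
    by rewrite -ss; field.
  + ring.
  + transitivity (s ^- 2 * (T + 1)); first by field.
    by rewrite -ss; field.
  + transitivity (c2 ^+ 2 / t ^+ 2 * (4 * T + 1)); first by field.
    by rewrite -tt; field.
- by move=> i j ij; rewrite aa /g ij; case: i {ij} => -[|[|[|[|[|]]]]] //= _; field;
    rewrite ?s0 ?t0 ?andbT.
Qed.

End Polarizations.

(** * Bounds on the norms *)

Section Denominator.
Variables (R : realType) (p n : R) (N : nat).
Hypothesis n0 : 0 < n.
Hypothesis np : n <= p.
Local Notation sx := (Num.sqrt (n / p)).
Local Notation y := ((Num.sqrt (n / p))^-1).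
Local Notation T := (N%:R ^+ 2 : R).
Local Notation ga := ((2 `^ p)^-1 ^+ 2 : R).
Hypothesis Ny : N%:R <= y + 1.

Let p0 : 0 < p. Proof. exact: lt_le_trans np. Qed.
Let sx0 : 0 < sx. Proof. by rewrite sqrtr_gt0 divr_gt0. Qed.
Let sx2 : sx ^+ 2 = n / p. Proof. by rewrite sqr_sqrtr // divr_ge0 // ltW. Qed.
Let y0 : 0 < y. Proof. by rewrite invr_gt0. Qed.

Let TU : T <= (y + 1) ^+ 2.
Proof. by rewrite ler_pXn2r // ?nnegrE ?ler0n // addr_ge0 // ltW. Qed.

(* Expansions of (y + 1)^2 + 1 and 4 (y + 1)^2 + 1, where 1 = y^2 n / p. *)
Let T1_le : T + 1 <= y ^+ 2 * (1 + 2 * sx + 2 * n / p).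
Proof.
rewrite (_ : _ * (_ + 2 * n / p) = (y + 1) ^+ 2 + 1); first by rewrite lerD2r.
by rewrite -[2 * n / p]mulrA; move: sx2 (negbT (gt_eqF sx0)); set s := Num.sqrt _ => <- s0; field.
Qed.

Let T4_le : 4 * T + 1 <= 4 * (y ^+ 2 * (1 + 2 * sx + 5 * n / (4 * p))).
Proof.
rewrite (_ : 4 * (_ * (_ + 5 * n / _)) = 4 * (y + 1) ^+ 2 + 1).
  by rewrite lerD2r ler_pM2l.
rewrite (_ : 5 * n / (4 * p) = 5 / 4 * (n / p)); last by field; rewrite gt_eqF.
by move: sx2 (negbT (gt_eqF sx0)); set s := Num.sqrt _ => <- s0; field.
Qed.

Let y2s s : (y ^+ 2) `^ s = y `^ s * y `^ s.
Proof. by rewrite expr2 powRM // ltW. Qed.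

Let np0 : 0 <= n / p. Proof. by rewrite divr_ge0 // ltW. Qed.
Let b2_ge0 : 0 <= 1 + 2 * sx + 2 * n / p.
Proof. by rewrite -[2 * n / p]mulrA; have := np0; have := sqrtr_ge0 (n / p); lra. Qed.
Let b5_ge0 : 0 <= 1 + 2 * sx + 5 * n / (4 * p).
Proof.
rewrite (_ : 5 * n / (4 * p) = 5 / 4 * (n / p)); last by field; rewrite gt_eqF.
by have := np0; have := sqrtr_ge0 (n / p); lra.
Qed.

Let half s : 0 <= s -> 2^-1 = (y ^+ 2) `^ s * (2^-1 * (n / p) `^ s).
Proof.
move=> s0; rewrite mulrCA -powRM ?sqr_ge0 // -[X in
  (_ * X) `^ _]sx2 -exprMn mulVf ?gt_eqF // expr1n.
by rewrite powR1 mulr1.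
Qed.

(** For s = p the second factor is that of Sigma, for s = n that of Upsilon: the exponent
2 p - 2 s of 2 comes from ga 4^s = 4^(s - p). *)
Lemma chain_sum_le s : 0 <= s -> chain_sum N ga s <=
  (y `^ s * y `^ s) * ((1 + 2 * sx + 2 * n / p) `^ s
    + (2 `^ (2 * p - 2 * s))^-1 * (1 + 2 * sx + 5 * n / (4 * p)) `^ s + 2^-1 * (n / p) `^ s).
Proof.
move=> s0; rewrite -y2s /chain_sum !mulrDr -half // lerD2r addrC.
have mono (u v : R) : 0 <= u -> u <= v -> u `^ s <= v `^ s.
  by move=> u0 uv; apply: ge0_ler_powR; rewrite ?nnegrE // (le_trans u0).
apply: lerD.
  by rewrite -powRM ?sqr_ge0 //; apply: mono => //; rewrite addr_ge0 ?sqr_ge0.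
have -> : (2 `^ (2 * p - 2 * s))^-1 = ga * 4 `^ s :> R.
  rewrite (_ : 4 = 2 `^ 2 :> R); last by rewrite (@powR_mulrn _ 2 2) //; ring.
  rewrite -powRN -[(2 `^ p)^-1]powRN -powR_mulrn ?powR_ge0 // -!powRrM.
  by rewrite -powRD ?pnatr_eq0 ?implybT //; congr (_ `^ _); ring.
rewrite -[_ * 4 `^ s * _]mulrA [leRHS]mulrCA ler_wpM2l ?sqr_ge0 // [leRHS]mulrCA -!powRM ?mulr_ge0
  ?sqr_ge0 //.
by apply: mono => //; rewrite addr_ge0 ?mulr_ge0 ?sqr_ge0.
Qed.

Lemma chain_den_le : chain_den N ga p n <= y `^ p * y `^ p * y `^ n * Gminus_den p n.
Proof.
rewrite /chain_den.
have sq s X : Num.sqrt (y `^ s * y `^ s * X) = y `^ s * Num.sqrt X.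
  by rewrite sqrtrM ?mulr_ge0 ?powR_ge0 // -expr2 sqrtr_sqr ger0_norm ?powR_ge0.
have HS : Num.sqrt (chain_sum N ga p) <= y `^ p * Num.sqrt (Sigma p n).
  rewrite -sq ler_wsqrtr //; apply: le_trans (chain_sum_le (ltW p0)) _.
  by rewrite subrr powRr0 invr1 mul1r [X in _ * (X + _)]addrC.
have HU : Num.sqrt (chain_sum N ga n) <= y `^ n * Num.sqrt (Upsilon p n).
  by rewrite -sq ler_wsqrtr //; exact: chain_sum_le (ltW n0).
have HN s : 0 <= s -> N%:R `^ s <= y `^ s * (1 + sx) `^ s.
  move=> s0; rewrite -powRM ?addr_ge0 ?(ltW y0) ?(ltW sx0) //.
  rewrite (_ : y * (1 + sx) = y + 1); last by field; rewrite gt_eqF.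
  by apply: ge0_ler_powR => //; rewrite nnegrE ?ler0n // addr_ge0 // ltW.
rewrite /Gminus_den.
set S := Num.sqrt (Sigma _ _) in HS *; set U := Num.sqrt (Upsilon _ _) in HU *.
have S0 : 0 <= S by exact: sqrtr_ge0.
have U0 : 0 <= U by exact: sqrtr_ge0.
rewrite (_ : _ * (_ * S) = ((y `^ p * (1 + sx) `^ p) * (y `^ n * U) + (y `^ n * (1 + sx) `^ n)
  * (y `^ p * S)) * (y `^ p * S)); last by ring.
apply: ler_pM => //; rewrite ?sqrtr_ge0 // ?addr_ge0 ?mulr_ge0 ?powR_ge0 ?sqrtr_ge0 //.
by apply: lerD; apply: ler_pM => //; rewrite ?powR_ge0 ?sqrtr_ge0 ?HN ?ltW.
Qed.

Lemma Gminus_den_gt0 : 0 < Gminus_den p n.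
Proof.
have S0 : 0 < Sigma p n.
  rewrite /Sigma ltr_wpDr ?mulr_ge0 ?powR_ge0 // ltr_wpDr ?powR_ge0 //.
  by rewrite powR_gt0 // -addrA ltr_pwDl // addr_ge0 ?mulr_ge0 ?invr_ge0 ?mulr_ge0 // ltW.
rewrite /Gminus_den mulr_gt0 ?sqrtr_gt0 // ltr_wpDl ?mulr_ge0 ?powR_ge0 ?sqrtr_ge0 //.
by rewrite mulr_gt0 ?sqrtr_gt0 // powR_gt0 // addr_gt0.
Qed.

(** The number [G] is nonnegative because [A] is positive, so that the denominator may be
replaced by its upper bound. *)
Lemma test_quotient_le (G A B : R) : 0 < A -> A <= B ->
  B <= G * chain_den N ga p n ->
  A / (y `^ p * y `^ p * y `^ n * Gminus_den p n) <= G.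
Proof.
move=> A0 AB BG.
have D0 := Gminus_den_gt0.
have D1 : 0 < y `^ p * y `^ p * y `^ n * Gminus_den p n.
  by apply: mulr_gt0 D0; rewrite !mulr_gt0 ?powR_gt0.
rewrite ler_pdivrMr //; apply: (le_trans (le_trans AB BG)).
apply: ler_wpM2l chain_den_le.
rewrite leNgt; apply/negP => G0.
have := lt_le_trans A0 (le_trans AB BG); rewrite ltNge => /negP; apply.
by rewrite nmulr_rle0 // /chain_den mulr_ge0 ?addr_ge0 ?mulr_ge0 ?powR_ge0 ?sqrtr_ge0.
Qed.

End Denominator.

(** * The bound in dimension at least three *)

Section Dimension3.
Variable R : realType.
Implicit Types p n : R.

Lemma exists_nat_near (y : R) : 0 <= y -> exists N : nat, [/\ (0 < N)%N, y <= N%:R & N%:R <= y + 1].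
Proof.
move=> y0; exists (Num.truncn y).+1; split=> //.
  by rewrite ltW // truncnS_gt.
by rewrite -natr1 lerD2r truncn_le.
Qed.

Lemma powR_le (s u v : R) : 0 <= s -> 0 <= u -> u <= v -> u `^ s <= v `^ s.
Proof. by move=> s0 u0 uv; apply: ge0_ler_powR; rewrite ?nnegrE // (le_trans u0). Qed.

Lemma powR_ge1 (s u : R) : 0 <= s -> 1 <= u -> 1 <= u `^ s.
Proof. by move=> s0 u1; apply: (@le_trans _ _ (1 `^ s)); [rewrite powR1|rewrite powR_le]. Qed.

Lemma powR_gt1 (s u : R) : 0 < s -> 1 < u -> 1 < u `^ s.
Proof. by move=> s0 u1; apply: (@le_lt_trans _ _ (1 `^ s)); [rewrite powR1|apply: gt0_ltr_powR];
  rewrite ?nnegrE // ltW // (lt_trans _ u1). Qed.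

Lemma powR4 (s : R) : 4 `^ s = 2 `^ s * 2 `^ s :> R.
Proof. by rewrite -powRM //; congr (_ `^ _); ring. Qed.

Lemma Gminus_dge3_le (d : nat) p n (G : R) : (3 <= d)%N -> n <= p -> d%:R / 2 + 1 < n ->
  kato_bound d p n G -> Gminus_dge3 d p n <= G.
Proof.
move=> d3 np dn K.
have n0 : 0 < n by apply: lt_trans dn; rewrite ltr_pwDr // divr_ge0.
have p0 : 0 < p by exact: lt_le_trans np.
have x0 : 0 < n / p by rewrite divr_gt0.
have x1 : n / p <= 1 by rewrite ler_pdivrMr // mul1r.
have sx0 : 0 < Num.sqrt (n / p) by rewrite sqrtr_gt0.
have y0 : 0 < (Num.sqrt (n / p))^-1 by rewrite invr_gt0.
have [N [N0 yN Ny]] := exists_nat_near (ltW y0).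
pose e0 : 'I_d := Ordinal (ltn_trans (ltn0Sn 1) d3).
pose e1 : 'I_d := Ordinal (ltn_trans (ltnSn 1) d3).
pose e2 : 'I_d := Ordinal d3.
have e01 : e0 != e1 by [].
have e20 : e2 != e0 by [].
have e21 : e2 != e1 by [].
have B := kato_chain_transverse e01 N0 e20 e21 K.
pose M := (1 + n / (4 * p)) `^ p * 2 `^ p + (1 - (2 `^ p)^-1) * (1 + n / p) `^ p - (n / p) `^ p.
pose c : R := Num.sqrt 2 * (2 * pi) `^ (- (d%:R / 2)).
have c0 : 0 < c by rewrite mulr_gt0 ?sqrtr_gt0 ?powR_gt0 ?mulr_gt0 ?pi_gt0.
have p2 : 1 < 2 `^ p :> R by rewrite powR_gt1 ?ltr1n.
have p2' : 0 <= 1 - (2 `^ p)^-1 :> R by rewrite subr_ge0 invf_le1 ?powR_gt0 // ltW.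
have x4 : n / (4 * p) = (n / p) / 4 by field; rewrite gt_eqF.
(* The first term of M exceeds 2^p > 1, and the last one is at most 1. *)
have M0 : 0 < M.
  rewrite subr_gt0; apply: (@le_lt_trans _ _ 1).
    by apply: (@le_trans _ _ (1 `^ p)); [apply: powR_le => //; exact: ltW|rewrite powR1].
  apply: ltr_wpDr; first by rewrite mulr_ge0 ?powR_ge0.
  apply: (lt_le_trans p2); rewrite ler_peMl ?powR_ge0 // powR_ge1 ?(ltW p0) // lerDl.
  by rewrite x4 divr_ge0 // ltW.
set y := (Num.sqrt (n / p))^-1 in y0 yN Ny.
have yx : y ^+ 2 * (n / p) = 1.
  by rewrite /y exprVn sqr_sqrtr ?mulVf ?gt_eqF // ltW.
have yp X s : 0 <= X -> y `^ s * y `^ s * X `^ s = (y ^+ 2 * X) `^ s.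
  by move=> X0; rewrite -!powRM ?mulr_ge0 ?(ltW y0) // expr2.
have AB : c * (y `^ p * y `^ p * M) <=
  c * ((2 `^ p)^-1 * ((4 * N%:R ^+ 2 + 1) `^ p - (N%:R ^+ 2 + 1) `^ p)
    + ((N%:R ^+ 2 + 1) `^ p - 1)).
  rewrite ler_pM2l //.
  have T1 : y ^+ 2 <= N%:R ^+ 2 by rewrite ler_pXn2r // nnegrE ?ler0n // ltW.
  (* The factor y^(2p) is absorbed into the bases of the powers, since y^2 n / p = 1; this is
     the numerator with y in place of N. *)
  have -> : y `^ p * y `^ p * M = (y ^+ 2 + 4^-1) `^ p * 2 `^ p + (1 - (2 `^ p)^-1)
    * (y ^+ 2 + 1) `^ p - 1.
    transitivity ((y `^ p * y `^ p * (1 + n / (4 * p)) `^ p) * 2 `^ p + (1 - (2 `^ p)^-1)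
      * (y `^ p * y `^ p * (1 + n / p) `^ p)
       - y `^ p * y `^ p * (n / p) `^ p); first by rewrite /M; ring.
    rewrite !yp ?addr_ge0 ?x4 ?(ltW x0) ?divr_ge0 ?(ltW n0) ?(ltW p0) //.
    by rewrite !mulrDr !mulr1 mulrA yx powR1 mul1r.
  rewrite (_ : 4 * N%:R ^+ 2 + 1 = 4 * (N%:R ^+ 2 + 4^-1)); last by field.
  rewrite powRM ?addr_ge0 ?sqr_ge0 // powR4.
  set Z := (N%:R ^+ 2 + 4^-1) `^ p; set W := (N%:R ^+ 2 + 1) `^ p.
  rewrite (_ : _ + (W - 1) = Z * 2 `^ p + (1 - (2 `^ p)^-1) * W - 1); last by field;
    rewrite gt_eqF ?powR_gt0.
  rewrite lerD2r; apply: lerD.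
    by rewrite ler_wpM2r ?powR_ge0 // powR_le ?(ltW p0) ?addr_ge0 ?sqr_ge0 ?lerD2r.
  by rewrite ler_wpM2l // powR_le ?(ltW p0) ?addr_ge0 ?sqr_ge0 ?lerD2r.
have yp0 s : 0 < y `^ s by rewrite powR_gt0.
have A0 : 0 < c * (y `^ p * y `^ p * M) by exact: mulr_gt0 c0
  (mulr_gt0 (mulr_gt0 (yp0 p) (yp0 p)) M0).
apply: le_trans (test_quotient_le n0 np Ny A0 AB B); rewrite le_eqVlt; apply/orP; left; apply/eqP.
rewrite -/y /Gminus_dge3 -/M /c powRN.
have -> : (n / p) `^ (n / 2) = (y `^ n)^-1.
  rewrite /y -powR12_sqrt ?(ltW x0) // -!powRN -powRrM.
  by congr (_ `^ _); ring.
have D0 := Gminus_den_gt0 n0 np.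
have tp0 : 0 < (2 * pi : R) `^ (d%:R / 2) by rewrite powR_gt0 // mulr_gt0 // pi_gt0.
move: (negbT (gt_eqF D0)) (negbT (gt_eqF (yp0 p))) (negbT (gt_eqF (yp0 n)))
  (negbT (gt_eqF tp0)) => h1 h2 h3 h4.
by field; rewrite h1 h2 h3 h4.
Qed.

End Dimension3.

(** * Comparison of the numerators in the plane *)

Section Planar.
Variable R : realType.

Lemma sqr_le_div (a b X Y : R) : 0 <= a -> 0 <= b -> 0 < X -> 0 < Y -> a ^+ 2 * Y <= b ^+ 2 * X ->
  a / Num.sqrt X <= b / Num.sqrt Y.
Proof.
move=> a0 b0 X0 Y0 H.
have sX : 0 < Num.sqrt X by rewrite sqrtr_gt0.
have sY : 0 < Num.sqrt Y by rewrite sqrtr_gt0.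
rewrite ler_pdivrMr // mulrAC ler_pdivlMr //.
rewrite -(@ler_pXn2r _ 2) ?nnegrE ?mulr_ge0 ?(ltW sX) ?(ltW sY) //.
by rewrite !exprMn !sqr_sqrtr ?(ltW X0) ?(ltW Y0).
Qed.

Section Coefficients.
Variables (T x : R).
Hypothesis T1 : 1 <= T.
Let T0 : 0 < T. Proof. exact: lt_le_trans T1. Qed.
Hypothesis x0 : 0 < x.
Hypothesis xT : 1 <= x * T.

(* As x T >= 1, with T = N^2 and x = n / p, the factors in x are at least
   those obtained for x = 1 / T. *)
Let key : (T + 1) * (T + 4) <= (1 + x) * (1 + 4 * x) * T ^+ 2.
Proof.
rewrite (_ : (1 + x) * (1 + 4 * x) * T ^+ 2 = (T + x * T) * (T + 4 * (x * T))); last by ring.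
by move: xT T1; set z := x * T => z1 t1; apply: ler_pM; lra.
Qed.

(** The two square roots are compared after replacing x by 1 / T, which leaves an inequality
between polynomials in T. *)
Lemma planar_coef (a b : R) : 0 <= a -> 0 <= b ->
  a ^+ 2 * ((T + 1) * (4 * T + 1)) * T ^+ 2 <= b ^+ 2 * ((T + 1) * (T + 4)) ->
  a / Num.sqrt ((1 + x) * (1 + 4 * x)) <= b / Num.sqrt ((T + 1) * (4 * T + 1)).
Proof.
move=> a0 b0 H; apply: sqr_le_div => //; try by rewrite mulr_gt0 //; have := T1; have := x0; lra.
rewrite -(@ler_pM2r _ (T ^+ 2)); last by rewrite exprn_gt0.
by apply: (le_trans H); rewrite -[leRHS]mulrA ler_wpM2l ?sqr_ge0.
Qed.

(** The constant 15 is the value of (1 + 2 T) (4 T + 1) at T = 1, where equality holds for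
x = 1. *)
Lemma planar_coef15 :
  15 / Num.sqrt ((1 + x) * (1 + 4 * x)) <=
  (1 + 2 * T) * (4 * T + 1) / Num.sqrt ((T + 1) * (4 * T + 1)).
Proof.
apply: planar_coef => //; first by rewrite mulr_ge0 //; have := T1; lra.
(* The difference vanishes at T = 1 and has nonnegative coefficients in w = T - 1. *)
rewrite -subr_ge0.
have [w w0 ->] : exists2 w : R, 0 <= w & T = 1 + w by exists (T - 1); [rewrite subr_ge0|ring].
rewrite (_ : _ - _ = (4 * (1 + w) + 1) * (2 + w) *
  (75 * w + 211 * w ^+ 2 + 148 * w ^+ 3 + 16 * w ^+ 4)); last by ring.
have w2 : 0 <= w ^+ 2 by exact: exprn_ge0.
have w3 : 0 <= w ^+ 3 by exact: exprn_ge0.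
have w4 : 0 <= w ^+ 4 by exact: exprn_ge0.
by clear key xT; apply: mulr_ge0; [apply: mulr_ge0|]; lra.
Qed.

(** As for the constant 15, with 9 the value of (1 + 2 T) 3 T at T = 1. *)
Lemma planar_coef9 :
  9 / Num.sqrt ((1 + x) * (1 + 4 * x)) <=
  (1 + 2 * T) * (3 * T) / Num.sqrt ((T + 1) * (4 * T + 1)).
Proof.
apply: planar_coef => //; first by rewrite mulr_ge0 //; have := T1; lra.
(* The difference vanishes at T = 1 and has nonnegative coefficients in w = T - 1. *)
rewrite -subr_ge0.
have [w w0 ->] : exists2 w : R, 0 <= w & T = 1 + w by exists (T - 1); [rewrite subr_ge0|ring].
rewrite (_ : _ - _ = 9 * (1 + w) ^+ 2 * (2 + w) * (33 * w + 32 * w ^+ 2 + 4 * w ^+ 3));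
  last by ring.
have w2 : 0 <= w ^+ 2 by exact: exprn_ge0.
have w3 : 0 <= w ^+ 3 by exact: exprn_ge0.
by clear key xT; rewrite !mulr_ge0 ?sqr_ge0 //; lra.
Qed.

(** With T = nu^2 this follows from 2 nu <= T + 1 and T (1 + x) >= T + 1. *)
Lemma planar_centre (nu C C' : R) : 1 <= nu -> T = nu ^+ 2 -> 1 <= C -> C <= C' ->
  (2 * C - 1) / Num.sqrt (1 + x) <= ((T + 1) * C' - 1) / Num.sqrt (T + 1).
Proof.
move=> nu1 TE C1 CC.
have N2 : nu * (2 * C - 1) <= (T + 1) * C' - 1.
  have : 2 * nu * C <= (T + 1) * C'.
    apply: ler_pM; try lra.
    by rewrite TE -subr_ge0 (_ : _ - _ = (nu - 1) ^+ 2); [rewrite sqr_ge0|ring].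
  by rewrite mulrBr mulr1; lra.
have C0 : 0 <= 2 * C - 1 by lra.
apply: (@le_trans _ _ (nu * (2 * C - 1) / Num.sqrt (T + 1))); last first.
  by rewrite ler_wpM2r // invr_ge0 sqrtr_ge0.
have x1 : 0 < 1 + x by rewrite addr_gt0.
have t1 : 0 < T + 1 by rewrite addr_gt0.
apply: sqr_le_div => //; first by rewrite mulr_ge0 // (le_trans ler01).
rewrite exprMn -TE [T * _]mulrC -[leRHS]mulrA; apply: ler_wpM2l; first exact: sqr_ge0.
by rewrite mulrDr mulr1 lerD2l mulrC.
Qed.

End Coefficients.

(** The difference is (z + 1)^r times ((4 z + 1) / (z + 1))^r - 1, and both factors are
nondecreasing in z. *)
Lemma powR_sub_homo (r a b : R) : 0 <= r -> 1 <= a -> a <= b ->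
  (4 * a + 1) `^ r - (a + 1) `^ r <= (4 * b + 1) `^ r - (b + 1) `^ r.
Proof.
move=> r0 a1 ab.
have b1 : 1 <= b by exact: le_trans ab.
have E (z : R) : 1 <= z -> (4 * z + 1) `^ r - (z + 1) `^ r =
  (z + 1) `^ r * (((4 * z + 1) / (z + 1)) `^ r - 1).
  move=> z1; rewrite mulrBr mulr1 -powRM; [|lra|by rewrite divr_ge0; lra].
  by congr (_ `^ _ - _); field; rewrite gt_eqF //; lra.
rewrite !E //; apply: ler_pM; rewrite ?powR_ge0 //.
- by rewrite subr_ge0 powR_ge1 // ler_pdivlMr; lra.
- by apply: powR_le => //; lra.
rewrite lerD2r; apply: powR_le => //; first by rewrite divr_ge0; lra.
rewrite ler_pdivrMr; last by lra.
rewrite mulrAC ler_pdivlMr; last by lra.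
rewrite -subr_ge0 (_ : _ - _ = 3 * (b - a)); last by ring.
by lra.
Qed.

(** Both sides are split in the same way.  With 4 T + 1 = |k_2|^2 and
T + 1 = |k_1|^2, the right-hand side is a combination of (4 T + 1)^r
  - (T + 1)^r, of (T + 1)^r, and of a
central term, where r = p - 1; the left-hand side is the same combination for y^2 in place of
T, with the constants 15 and 9 in place of the polynomial coefficients.  The terms are then
compared one by one. *)
Lemma planar_numerator_le (n p nu : R) : 0 < n -> n <= p -> 1 < p -> 1 <= nu ->
  let y := (Num.sqrt (n / p))^-1 in let T := nu ^+ 2 in
  y <= nu ->
  y `^ (p - 1) * y `^ (p - 1) *
    (15 * (1 + n / (4 * p)) `^ (p - 1) * 2 `^ (p - 2)
      + (1 + n / p) `^ (p - 1) * (2 * Num.sqrt (1 + 4 * n / p) - 3 / 2 `^ (p - 1))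
      - Num.sqrt (1 + 4 * n / p) * (n / p) `^ (p - 1)) / Num.sqrt ((1 + n / p) * (1 + 4 * n / p)) <=
   ((2 `^ p)^-1 * (1 + 2 * T) / (Num.sqrt (T + 1) * Num.sqrt (4 * T + 1))
     * ((4 * T + 1) `^ p - (T + 1) `^ p)
      + (Num.sqrt (T + 1))^-1 * ((T + 1) `^ p - 1)).
Proof.
move=> n0 np p1 nu1 y T ynu.
have p0 : 0 < p by exact: lt_trans p1.
have x4 : n / (4 * p) = (n / p) / 4 by field; rewrite gt_eqF.
have x44 : 4 * n / p = 4 * (n / p) by rewrite mulrA.
have x0 : 0 < n / p by rewrite divr_gt0.
have x1 : n / p <= 1 by rewrite ler_pdivrMr // mul1r.
rewrite x4 x44.
have yx : y ^+ 2 * (n / p) = 1.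
  by rewrite /y exprVn sqr_sqrtr ?mulVf ?gt_eqF // ltW.
have y0 : 0 < y by rewrite invr_gt0 sqrtr_gt0.
clearbody y; move: x0 x1 yx; set x := n / p => x0 x1 yx.
clearbody x; clear n0 np x4 x44.
have q1 : 1 <= y ^+ 2.
  by rewrite -yx -[leRHS]mulr1 ler_pM2l // exprn_gt0.
have qT : y ^+ 2 <= T by rewrite ler_pXn2r // ?nnegrE; [exact: ltW|exact: le_trans nu1].
have T1 : 1 <= T by exact: le_trans qT.
have xT : 1 <= x * T by rewrite -yx [leRHS]mulrC ler_pM2r.
pose r := p - 1.
have r0 : 0 <= r by rewrite subr_ge0 ltW.
have Ep z : 0 < z -> z `^ p = z * z `^ r.
  move=> z0; rewrite -{2}[z]powRr1 ?(ltW z0) // -powRD; last by rewrite (gt_eqF z0) implybT.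
  by congr (_ `^ _); rewrite /r; ring.
have yp X : 0 <= X -> y `^ r * y `^ r * X `^ r = (y ^+ 2 * X) `^ r.
  by move=> X0; rewrite -!powRM ?mulr_ge0 ?(ltW y0) // expr2.
set q := y ^+ 2 in q1 qT yx yp.
have I1 := planar_coef15 T1 x0 xT; have I2 := planar_coef9 T1 x0 xT.
have C1 : 1 <= (q + 1) `^ r by apply: powR_ge1; rewrite // lerDr (le_trans ler01).
have CC : (q + 1) `^ r <= (T + 1) `^ r by apply: powR_le;
  rewrite ?lerD2r // addr_ge0 // (le_trans ler01).
have I3 := planar_centre T1 x0 xT nu1 erefl C1 CC.
have BC := powR_sub_homo r0 q1 qT.
have q0 : 0 < q by exact: lt_le_trans q1.
have T0 : 0 < T by exact: lt_le_trans T1.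
have h0 : 0 < 2 `^ r :> R by rewrite powR_gt0.
have E2 : 2 `^ p = 2 * 2 `^ r :> R by rewrite Ep.
have E22 : 2 `^ (p - 2) = 2 `^ r / 2 :> R.
  rewrite (_ : p - 2 = r - 1); last by rewrite /r; ring.
  by rewrite powRB ?powRr1 // pnatr_eq0 implybT.
have EB : y `^ r * y `^ r * (1 + x / 4) `^ r = (4 * q + 1) `^ r / (2 `^ r * 2 `^ r).
  rewrite yp ?addr_ge0 ?divr_ge0 ?(ltW x0) // -powR4 mulrDr mulr1 mulrA yx.
  have -> : 4 * q + 1 = 4 * (q + 1 / 4) by field.
  rewrite powRM ?addr_ge0 ?divr_ge0 ?(ltW q0) // mulrAC mulfV ?mul1r //.
have EC : y `^ r * y `^ r * (1 + x) `^ r = (q + 1) `^ r.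
  by rewrite yp ?addr_ge0 ?(ltW x0) // mulrDr mulr1 yx.
have E1 : y `^ r * y `^ r * x `^ r = 1.
  by rewrite yp ?(ltW x0) // yx powR1.
have u0 : 0 < Num.sqrt (1 + x) by rewrite sqrtr_gt0 addr_gt0.
have v0 : 0 < Num.sqrt (1 + 4 * x) by rewrite sqrtr_gt0 addr_gt0 // mulr_gt0.
have s0 : 0 < Num.sqrt (T + 1) by rewrite sqrtr_gt0 addr_gt0.
have t0 : 0 < Num.sqrt (4 * T + 1) by rewrite sqrtr_gt0 addr_gt0 // mulr_gt0.
move: I1 I2; rewrite !sqrtrM ?addr_ge0 ?(ltW x0) ?(ltW T0) //.
have EA := Ep (4 * T + 1) (addr_gt0 (mulr_gt0 (ltr0n _ 4) T0) ltr01).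
have ET := Ep (T + 1) (addr_gt0 T0 ltr01).
rewrite EA ET E2 E22 -/r.
move: I3 BC EB EC E1 C1 CC u0 v0 s0 t0 h0.
set u := Num.sqrt (1 + x); set v := Num.sqrt (1 + 4 * x); set s := Num.sqrt (T + 1).
set t := Num.sqrt (4 * T + 1); set h := 2 `^ r.
set B := (4 * q + 1) `^ r; set C := (q + 1) `^ r; set B' := (4 * T + 1) `^ r;
  set C' := (T + 1) `^ r.
set Y := y `^ r * y `^ r.
move=> I3 BC EB EC E1 C1 CC u0 v0 s0 t0 h0 I1 I2.
(* From 15 (B - C) + 9 C = 15 B - 6 C, the term -3 / 2^(p - 1) of the numerator becomes
   the correction from 15 to 9, and the remaining terms form the central one. *)
have -> : Y * (15 * (1 + x / 4) `^ r * (h / 2) + (1 + x) `^ r * (2 * v - 3 / h) - v * x `^ r)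
  / (u * v)
   = (2 * h)^-1 * (15 / (u * v) * (B - C) + 9 / (u * v) * C) + (2 * C - 1) / u.
  transitivity ((15 * (Y * (1 + x / 4) `^ r) * (h / 2) + (Y * (1 + x) `^ r) * (2 * v - 3 / h) - v
    * (Y * x `^ r)) / (u * v)).
    by congr (_ / _); ring.
  by rewrite EB EC E1; field; rewrite !gt_eqF.
have -> : (2 * h)^-1 * (1 + 2 * T) / (s * t) * ((4 * T + 1) * B' - (T + 1) * C') + s^-1
  * ((T + 1) * C' - 1)
  = (2 * h)^-1 * ((1 + 2 * T) * (4 * T + 1) / (s * t) * (B' - C') + (1 + 2 * T) * (3 * T) / (s * t)
    * C')
    + ((T + 1) * C' - 1) / s.
  by field; rewrite !gt_eqF.
have uv0 : 0 < u * v by rewrite mulr_gt0.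
have BC0 : 0 <= B - C.
  by rewrite subr_ge0 /B /C; apply: powR_le => //;
    [rewrite addr_ge0 // ltW|rewrite lerD2r ler_peMl // ?ler1n // ltW].
apply: lerD I3; rewrite ler_pM2l ?invr_gt0 ?mulr_gt0 //; apply: lerD; apply: ler_pM => //.
- by rewrite divr_ge0 // ltW.
- by rewrite divr_ge0 // ltW.
- exact: le_trans C1.
Qed.

End Planar.

(** * The bound in the plane *)

Section Dimension2.
Variable R : realType.
Implicit Types p n : R.

Lemma planar_numerator_gt0 n p : 0 < n -> n <= p -> 2 < p ->
   0 < 15 * (1 + n / (4 * p)) `^ (p - 1) * 2 `^ (p - 2)
      + (1 + n / p) `^ (p - 1) * (2 * Num.sqrt (1 + 4 * n / p) - 3 / 2 `^ (p - 1))
      - Num.sqrt (1 + 4 * n / p) * (n / p) `^ (p - 1).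
Proof.
move=> n0 np p2.
have p0 : 0 < p by apply: lt_trans p2.
have x0 : 0 < n / p by rewrite divr_gt0.
have x1 : n / p <= 1 by rewrite ler_pdivrMr // mul1r.
have r0 : 0 <= p - 1 by lra.
have v1 : 1 <= Num.sqrt (1 + 4 * n / p).
  by rewrite -[leLHS]sqrtr1 ler_wsqrtr // lerDl -mulrA mulr_ge0 // ltW.
have h2 : 2 <= 2 `^ (p - 1) :> R by rewrite -[leLHS]powRr1 // ler_powR // ?ler1n //; lra.
have h3 : 3 / 2 `^ (p - 1) <= 3 / 2 :> R.
  by rewrite ler_wpM2l // lef_pV2 // posrE ?powR_gt0.
have P : 1 <= (1 + n / p) `^ (p - 1) by apply: powR_ge1; rewrite // lerDl ltW.
have Q : (n / p) `^ (p - 1) <= 1.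
  by apply: (@le_trans _ _ (1 `^ (p - 1))); [apply: powR_le => //; exact: ltW|rewrite powR1].
have W : 1 <= 15 * (1 + n / (4 * p)) `^ (p - 1) * 2 `^ (p - 2).
  have a1 : 1 <= (1 + n / (4 * p)) `^ (p - 1).
    by apply: powR_ge1; rewrite // lerDl divr_ge0 ?mulr_ge0 // ltW.
  have a2 : 1 <= 2 `^ (p - 2) :> R by apply: powR_ge1; rewrite ?ler1n //; lra.
  by apply: mulr_ege1 => //; apply: mulr_ege1 => //; rewrite ler1n.
move: v1 h3 P Q W; set v := Num.sqrt _; set a := 3 / _; set b := (1 + _) `^ _;
  set c := (n / p) `^ _; set g := _ * 2 `^ _.
move=> v1 h3 P Q W.
have : 1 * (2 * v - 3 / 2) <= b * (2 * v - a) by apply: ler_pM => //; lra.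
have : v * c <= v * 1 by apply: ler_wpM2l => //; lra.
lra.
Qed.

Lemma Gminus_d2_le p n (G : R) : n <= p -> 2 < n -> kato_bound 2 p n G -> Gminus_d2 p n <= G.
Proof.
move=> np n2 K.
have n0 : 0 < n by apply: lt_trans n2.
have p2 : 2 < p by exact: lt_le_trans np.
have p0 : 0 < p by exact: lt_le_trans np.
have p1 : 1 < p by apply: lt_trans p2; rewrite ltr1n.
have x0 : 0 < n / p by rewrite divr_gt0.
have sx0 : 0 < Num.sqrt (n / p) by rewrite sqrtr_gt0.
have y0 : 0 < (Num.sqrt (n / p))^-1 by rewrite invr_gt0.
have [N [N0 yN Ny]] := exists_nat_near (ltW y0).
have B := @kato_chain_planar R 2 0 1 isT N N0 p n G K.
have nu1 : 1 <= N%:R :> R by rewrite ler1n.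
have A := planar_numerator_le n0 np p1 nu1 yN.
have M0 := planar_numerator_gt0 n0 np p2.
pose c : R := Num.sqrt 2 * (2 * pi) `^ (- (2%:R / 2)).
have c0 : 0 < c by rewrite mulr_gt0 ?sqrtr_gt0 ?powR_gt0 ?mulr_gt0 ?pi_gt0.
have AB := A; rewrite /= -(ler_pM2l c0) in AB.
set M := _ - _ in M0; rewrite -/M in AB.
set V := Num.sqrt ((1 + n / p) * _) in AB.
have V0 : 0 < V by rewrite sqrtr_gt0 mulr_gt0 // addr_gt0 // -mulrA mulr_gt0.
set y := (Num.sqrt (n / p))^-1 in y0 yN Ny AB.
have yp0 s : 0 < y `^ s by rewrite powR_gt0.
have A0 : 0 < c * (y `^ (p - 1) * y `^ (p - 1) * M / V).
  exact: mulr_gt0 c0 (divr_gt0 (mulr_gt0 (mulr_gt0 (yp0 _) (yp0 _)) M0) V0).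
apply: le_trans (test_quotient_le n0 np Ny A0 AB B); rewrite le_eqVlt; apply/orP; left; apply/eqP.
rewrite -/y /Gminus_d2 -/M -/V /c.
(* The exponent n / 2 + 1 instead of n / 2: only y^(2p - 2) has been absorbed into the
   numerator, so that a factor y^(-2) = n / p is left over. *)
have -> : (n / p) `^ (n / 2 + 1) = (y `^ n)^-1 * (n / p).
  rewrite powRD; last by rewrite (gt_eqF x0) implybT.
  rewrite powRr1 ?(ltW x0) //; congr (_ * _).
  by rewrite /y -powR12_sqrt ?(ltW x0) // -!powRN -powRrM; congr (_ `^ _); ring.
have yx : n / p = y ^- 2.
  by rewrite /y exprVn invrK sqr_sqrtr // ltW.
rewrite yx.
have Ep : y `^ p = y * y `^ (p - 1).
  rewrite -{2}[y]powRr1 ?(ltW y0) // -powRD; last by rewrite (gt_eqF y0) implybT.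
  by congr (_ `^ _); ring.
rewrite Ep.
have -> : (2 * pi : R) `^ (- (2%:R / 2)) = (2 * pi)^-1.
  by rewrite divff ?pnatr_eq0 // powR_inv1 // mulr_ge0 // pi_ge0.
have D0 := Gminus_den_gt0 n0 np.
move: (negbT (gt_eqF D0)) (negbT (gt_eqF (yp0 (p - 1)))) (negbT (gt_eqF (yp0 n)))
  (negbT (gt_eqF y0)) (negbT (gt_eqF V0)) (negbT (gt_eqF (pi_gt0 R))) => h1 h2 h3 h4 h5 h6.
move: h6; move: (pi : R) => P h6.
have s0 : Num.sqrt 2 != 0 :> R by rewrite gt_eqF // sqrtr_gt0.
have -> : (Num.sqrt 2 * P * V)^-1 = Num.sqrt 2 / (2 * P * V) :> R.
  transitivity (Num.sqrt 2 / (Num.sqrt 2 ^+ 2 * P * V) : R); last by rewrite sqr_sqrtr.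
  by field; rewrite s0 h5 h6.
by field; rewrite h1 h2 h3 h4 h5 h6.
Qed.

End Dimension2.

(** * Powers with large exponents *)

Section Expansion.
Variable R : realType.
Implicit Types p n u : R.

(** The function in the middle has derivative t^2 / (1 + t), which is at most u^2 on the
segment from 0 to u. *)
Lemma ln1D_bound u : 0 < u -> 0 <= ln (1 + u) - u + u ^+ 2 / 2 <= u ^+ 3.
Proof.
move=> u0.
pose f (t : R) := ln (1 + t) - t + t ^+ 2 / 2.
pose df (t : R) := t ^+ 2 / (1 + t).
have D (t : R) : 0 <= t -> is_derive t (1:R) f (df t).
  move=> t0; have t1 : 0 < 1 + t by apply: ltr_pwDl.
  have D1 : is_derive t (1:R) (fun t :
    R => 1 + t) (1:R) by apply: (is_derive_eq
      (is_deriveD (is_derive_cst (1:R) t 1) (is_derive_id t 1))); rewrite add0r.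
  have D2 := @is_derive1_comp R (@ln R) _ t _ _ (is_derive1_ln t1) D1.
  have D3 : is_derive t (1:R) (fun t : R => t ^+ 2 / 2) t.
    by apply: is_derive_eq; rewrite /GRing.scale /=; field.
  apply: (is_derive_eq (is_deriveD (is_deriveB D2 (is_derive_id t 1)) D3)).
  by rewrite /df; field; rewrite gt_eqF.
have cf : {within `[0, u], continuous f}.
  apply: derivable_within_continuous => t; rewrite in_itv /= => /andP[t0 _].
  exact: (@ex_derive _ _ _ _ _ _ _ (D t t0)).
have [|c] := @MVT_segment R f df 0 u (ltW u0) _ cf.
  by move=> t; rewrite in_itv /= => /andP[t0 _]; exact: D (ltW t0).
rewrite in_itv /= => /andP[c0 cu]; rewrite {2}/f addr0 ln1 expr0n /= mul0r subrr addr0 !subr0 => E.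
rewrite -/(f u) E; have c1 : 0 < 1 + c by apply: ltr_pwDl.
apply/andP; split; first by rewrite mulr_ge0 ?(ltW u0) // divr_ge0 ?sqr_ge0 // ltW.
rewrite exprSr ler_pM2r // ler_pdivrMr //.
apply: (@le_trans _ _ (u ^+ 2)); first by rewrite ler_pXn2r // nnegrE // ltW.
by rewrite ler_peMr ?sqr_ge0 // lerDl.
Qed.

Lemma cvg_near_eq (f g : R -> R) (l : R) : (\forall p \near +oo, f p = g p) ->
  f p @[p --> +oo] --> l -> g p @[p --> +oo] --> l.
Proof. by move=> E; apply: cvg_trans; exact: near_eq_cvg. Qed.

(** In ln (1 + u) = u - u^2 / 2 + O (u^3) the remainder stays negligible after multiplication by
p, since p u^3 is u times the convergent p u^2. *)
Lemma cvg_powR_expR (u : R -> R) (b : R) :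
  (\forall p \near +oo, 0 < u p) -> u p @[p --> +oo] --> 0 -> p * u p ^+ 2 @[p --> +oo] --> b ->
  (1 + u p) `^ p / expR (p * u p) @[p --> +oo] --> expR (- b / 2).
Proof.
move=> up u0 ub.
pose h p := p * (ln (1 + u p) - u p).
have H : h p @[p --> +oo] --> - b / 2.
  have -> : - b / 2 = 0 - b / 2 by rewrite sub0r mulNr.
  apply: (@cvg_near_eq (fun p => p * (ln (1 + u p) - u p + u p ^+ 2 / 2) - p * u p ^+ 2 / 2)).
    by apply: nearW => p; rewrite /h; field.
  apply: cvgB; last exact: cvgMl.
  have L : p * u p ^+ 2 * u p @[p --> +oo] --> 0.
    by rewrite -(mulr0 b); exact: cvgM.
  apply: (@squeeze_cvgr _ _ _ _ (fun=> 0) _ _ _ _ _ L); last exact: cvg_cst.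
  near=> p.
  have p0 : 0 < p by near: p; exact: nbhs_pinfty_gt.
  have u1 : 0 < u p by near: p.
  have /andP[h1 h2] := ln1D_bound u1.
  by rewrite mulr_ge0 ?(ltW p0) //= -mulrA -exprSr ler_pM2l.
apply: (@cvg_near_eq (expR \o h)); last first.
  by apply: continuous_cvg H; exact: continuous_expR.
near=> p; have u1 : 0 < u p by near: p.
have u2 : 1 + u p != 0 by rewrite gt_eqF // ltr_pwDl // ltW.
by rewrite /h /= /powR (negbTE u2) -expRN -expRD; congr expR; ring.
Unshelve. all: by end_near.
Qed.

End Expansion.

Section PowerLimits.
Variable R : realType.
Variable n : R.
Hypothesis n0 : 0 < n.
Implicit Types p : R.
Local Notation s := (fun p : R => Num.sqrt (n / p)).

Lemma near_gt (a : R) : \forall p \near +oo, a < p.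
Proof. by apply: nbhs_pinfty_gt; exact: num_real. Qed.

Lemma cvg_ratio : n / p @[p --> +oo] --> 0.
Proof.
rewrite -(mulr0 n); apply: cvgMr.
apply/(@gtr0_cvgV0 R R (pinfty_nbhs R) _ id); first exact: near_gt.
exact: cvg_id.
Qed.

Lemma cvg_sqrt_ratio : s p @[p --> +oo] --> 0.
Proof.
rewrite -[X in _ --> X]sqrtr0; apply: (@continuous_cvg _ _ _ _ _ (fun p => n / p) Num.sqrt 0).
  exact: sqrt_continuous.
exact: cvg_ratio.
Qed.

Lemma near_s_gt0 : \forall p \near +oo, 0 < s p.
Proof. by near=> p; rewrite sqrtr_gt0 divr_gt0 //; near: p; exact: near_gt. Unshelve.
  all: by end_near. Qed.

Lemma near_s_sq : \forall p \near +oo, p * s p ^+ 2 = n.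
Proof.
near=> p; have p0 : 0 < p by near: p; exact: near_gt.
by rewrite sqr_sqrtr ?divr_ge0 ?ltW // mulrCA mulfV ?mulr1 // gt_eqF.
Unshelve. all: by end_near. Qed.

Lemma near_sqrt_np : \forall p \near +oo, Num.sqrt (n * p) = p * s p.
Proof.
near=> p; have p0 : 0 < p by near: p; exact: near_gt.
rewrite (_ : n * p = p ^+ 2 * (n / p)); last by field; rewrite gt_eqF.
by rewrite sqrtrM ?sqr_ge0 // sqrtr_sqr ger0_norm // ltW.
Unshelve. all: by end_near. Qed.

(** With u = 2 s + c s^2 and p s^2 = n one has p u = 2 sqrt (n p) + c n and p u^2 -> 4 n. *)
Lemma cvg_pow_sqrt_ratio (c : R) : 0 <= c ->
  (1 + 2 * s p + c * (n / p)) `^ p / expR (2 * Num.sqrt (n * p)) @[p --> +oo] -->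
    expR ((c - 2) * n).
Proof.
move=> c0.
pose u p := 2 * s p + c * (n / p).
have up : \forall p \near +oo, 0 < u p.
  near=> p; have p0 : 0 < p by near: p; exact: near_gt.
  have s0 : 0 < s p by near: p; exact: near_s_gt0.
  by rewrite /u ltr_pwDl // ?mulr_gt0 // mulr_ge0 // divr_ge0 // ltW.
have u0 : u p @[p --> +oo] --> 0.
  rewrite (_ : 0 = 2 * 0 + c * 0 :> R); last by ring.
  by apply: cvgD; apply: cvgMr; [exact: cvg_sqrt_ratio|exact: cvg_ratio].
have ub : p * u p ^+ 2 @[p --> +oo] --> 4 * n.
  apply: (@cvg_near_eq _ (fun p => n * (2 + c * s p) ^+ 2)).
    near=> p.
    have sq : p * s p ^+ 2 = n by near: p; exact: near_s_sq.
    have E : n / p = s p ^+ 2.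
      by rewrite sqr_sqrtr // divr_ge0 ?ltW //; near: p; exact: near_gt.
    rewrite /u; move: sq E; set t := Num.sqrt _ => sq ->.
    by rewrite -[in LHS]sq; ring.
  rewrite (_ : 4 * n = n * (2 + c * 0) ^+ 2); last by ring.
  apply: cvgMr; rewrite expr2; under eq_fun do rewrite expr2.
  by apply: cvgM; apply: cvgD; [exact: cvg_cst|apply: cvgMr;
    exact: cvg_sqrt_ratio|exact: cvg_cst|apply: cvgMr; exact: cvg_sqrt_ratio].
have := cvg_powR_expR up u0 ub.
move=> /(@cvgMl _ _ _ _ _ _ (expR (c * n))) H.
rewrite (_ : expR ((c - 2) * n) = expR (- (4 * n) / 2) * expR (c * n)); last by rewrite -expRD;
  congr expR; field.
apply: cvg_near_eq H.
near=> p; have p0 : 0 < p by near: p; exact: near_gt.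
have -> : Num.sqrt (n * p) = p * s p by near: p; exact: near_sqrt_np.
have -> : p * u p = 2 * (p * s p) + c * n by rewrite /u; field; rewrite gt_eqF.
by rewrite /u addrA [expR (_ + _)]expRD; field; rewrite !gt_eqF ?expR_gt0.
Unshelve. all: by end_near. Qed.

Lemma cvg_pow_1Dsqrt : (1 + s p) `^ p / expR (Num.sqrt (n * p)) @[p --> +oo] --> expR (- n / 2).
Proof.
have ub : p * s p ^+ 2 @[p --> +oo] --> n.
  by apply: (@cvg_near_eq _ (fun=> n));
    [near=> p; apply/esym; near: p; exact: near_s_sq|exact: cvg_cst].
apply: cvg_near_eq (cvg_powR_expR near_s_gt0 cvg_sqrt_ratio ub).
near=> p; congr (_ / expR _); apply/esym; near: p; exact: near_sqrt_np.
Unshelve. all: by end_near. Qed.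

Lemma cvg_pow_1Dratio (c : R) : 0 < c -> (1 + c * (n / p)) `^ p @[p --> +oo] --> expR (c * n).
Proof.
move=> c0.
have up : \forall p \near +oo, 0 < c * (n / p).
  by near=> p; rewrite mulr_gt0 // divr_gt0 //; near: p; exact: near_gt.
have u0 : c * (n / p) @[p --> +oo] --> 0 by rewrite -(mulr0 c); apply: cvgMr; exact: cvg_ratio.
have ub : p * (c * (n / p)) ^+ 2 @[p --> +oo] --> 0.
  apply: (@cvg_near_eq _ (fun p => (c ^+ 2 * n) * (n / p))).
    by near=> p; field; rewrite gt_eqF //; near: p; exact: near_gt.
  by rewrite -(mulr0 (c ^+ 2 * n)); apply: cvgMr; exact: cvg_ratio.
have := cvg_powR_expR up u0 ub.
move=> /(@cvgMl _ _ _ _ _ _ (expR (c * n))) H.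
have -> : expR (c * n) = expR (- 0 / 2) * expR (c * n) by rewrite oppr0 mul0r expR0 mul1r.
apply: cvg_near_eq H.
near=> p; have p0 : 0 < p by near: p; exact: near_gt.
rewrite (_ : p * _ = c * n); last by field; rewrite gt_eqF.
by rewrite mulfVK // gt_eqF ?expR_gt0.
Unshelve. all: by end_near. Qed.

End PowerLimits.

(** * Limits of the denominator *)

Section SigmaUpsilonLimits.
Variable R : realType.
Variable n : R.
Hypothesis n0 : 0 < n.
Implicit Types p : R.
Local Notation s := (fun p : R => Num.sqrt (n / p)).
Local Notation e1 := (fun p : R => expR (Num.sqrt (n * p))).

Lemma cvg_powR1 (u : R -> R) (a : R) : u p @[p --> +oo] --> 0 -> (1 + u p) `^ a @[p --> +oo] -->
  (1:R).
Proof.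
move=> u0.
have H : a * ln (1 + u p) @[p --> +oo] --> 0.
  rewrite -(mulr0 a) -[X in a * X](ln1 R); apply: cvgMr.
  apply: (@continuous_cvg _ _ _ _ _ (fun p => 1 + u p) (@ln R) 1).
    exact: continuous_ln.
  by rewrite -[X in _ --> X]addr0; apply: cvgD => //; exact: cvg_cst.
apply: (@cvg_near_eq _ (fun p => expR (a * ln (1 + u p)))).
  near=> p.
  have up : -1 < u p by near: p; apply: (cvgr_gt _ u0); exact: ltrN10.
  have u1 : 0 < 1 + u p by rewrite -(subrr 1) ltrD2l.
  by rewrite /powR gt_eqF.
by rewrite -[X in _ --> X](expR0 R); apply: continuous_cvg H; exact: continuous_expR.
Unshelve. all: by end_near. Qed.

Lemma cvg_ratio_powR (f : R -> R) : (\forall p \near +oo, 1 <= f p) ->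
  (n / p) `^ (f p) @[p --> +oo] --> 0.
Proof.
move=> f1.
apply: (@squeeze_cvgr _ _ _ _ (fun=> 0) (fun p => n / p)); last 2 first.
- exact: cvg_cst.
- exact: cvg_ratio.
near=> p; have p0 : n < p by near: p; exact: near_gt.
have p1 := lt_trans n0 p0.
have f1p : 1 <= f p by near: p.
rewrite powR_ge0 /= -[leRHS]powRr1; last by rewrite divr_ge0 ?ltW.
by apply: ger_powR => //; rewrite divr_gt0 // ler_pdivrMr // mul1r ltW.
Unshelve. all: by end_near. Qed.

(** By 2^x >= 1 + x ln 2 this is bounded by a multiple of 1 / p. *)
Lemma cvg_pow2MV (c : R) : 0 < c -> (2 `^ (c * p))^-1 @[p --> +oo] --> (0:R).
Proof.
move=> c0.
apply: (@squeeze_cvgr _ _ _ _ (fun=> 0) (fun p => (c * ln 2)^-1 / p)); last 2 first.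
- exact: cvg_cst.
- rewrite -(mulr0 ((c * ln 2)^-1)); apply: cvgMr.
  apply/(@gtr0_cvgV0 R R (pinfty_nbhs R) _ id); first exact: near_gt.
  exact: cvg_id.
have l2 : 0 < ln 2 :> R by rewrite ln_gt0 // ltr1n.
near=> p; have p0 : 0 < p by near: p; exact: near_gt.
rewrite invr_ge0 powR_ge0 /= -invfM lef_pV2 ?posrE ?powR_gt0 ?mulr_gt0 //.
rewrite /powR pnatr_eq0 /= (_ : c * ln 2 * p = c * p * ln 2); last by ring.
by apply: le_trans (expR_ge1Dx _); rewrite lerDr.
Unshelve. all: by end_near. Qed.

(** The first two terms have c = 5/4 and c = 2 in [cvg_pow_sqrt_ratio]; the last one is
negligible. *)
Lemma cvg_Sigma : Sigma p n / expR (2 * Num.sqrt (n * p)) @[p --> +oo] --> 1 + expR (- (3 * n / 4)).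
Proof.
have H1 := cvg_pow_sqrt_ratio n0 (divr_ge0 (ler0n R 5) (ler0n R 4)).
have H2 := cvg_pow_sqrt_ratio n0 (ler0n R 2).
have H3 : 2^-1 * ((n / p) `^ p) / expR (2 * Num.sqrt (n * p)) @[p --> +oo] --> 0.
  apply: (@squeeze_cvgr _ _ _ _ (fun=> 0) (fun p => (n / p) `^ p)); last 2 first.
  - exact: cvg_cst.
  - by apply: (cvg_ratio_powR (f := id)); near=> p; apply: ltW; near: p; exact: near_gt.
  near=> p; rewrite divr_ge0 ?mulr_ge0 ?powR_ge0 ?expR_ge0 //=.
  rewrite ler_pdivrMr ?expR_gt0 // mulrC ler_wpM2l ?powR_ge0 //.
  apply: (@le_trans _ _ 1); first by rewrite invf_le1 // ler1n.
  by rewrite -[leLHS](expR0 R) ler_expR mulr_ge0 // sqrtr_ge0.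
rewrite (_ : 1 + expR (- (3 * n / 4)) = expR ((5 / 4 - 2) * n) + expR ((2 - 2) * n) + 0);
  last first.
  by rewrite subrr mul0r expR0 addr0 addrC; congr (expR _ + _); field.
apply: cvg_near_eq (cvgD (cvgD H1 H2) H3).
near=> p; have p0 : 0 < p by near: p; exact: near_gt.
rewrite /Sigma (_ : 5 * n / (4 * p) = 5 / 4 * (n / p)); last by field; rewrite gt_eqF.
by rewrite -[2 * n / p]mulrA [RHS]mulrDl [X in _ = X + _]mulrDl.
Unshelve. all: by end_near. Qed.

Lemma cvg_sqrtSigma : Num.sqrt (Sigma p n) / e1 p @[p --> +oo] -->
  Num.sqrt (1 + expR (- (3 * n / 4))).
Proof.
apply: (@cvg_near_eq _ (fun p => Num.sqrt (Sigma p n / expR (2 * Num.sqrt (n * p))))); last first.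
  by apply: continuous_cvg cvg_Sigma; exact: sqrt_continuous.
apply: nearW => p /=.
rewrite expRM_natl -exprVn [_ * _ ^+ 2]mulrC sqrtrM ?sqr_ge0 // sqrtr_sqr.
by rewrite ger0_norm ?invr_ge0 ?expR_ge0 // mulrC.
Qed.

Lemma cvg_Upsilon : 1 <= n -> Upsilon p n @[p --> +oo] --> (1 : R).
Proof.
move=> n1.
have H1 (c : R) : (1 + (2 * s p + c * (n / p))) `^ n @[p --> +oo] --> (1:R).
  apply: cvg_powR1; rewrite (_ : 0 = 2 * 0 + c * 0 :> R); last by ring.
  by apply: cvgD; apply: cvgMr; [exact: cvg_sqrt_ratio|exact: cvg_ratio].
have H2 : (2 `^ (2 * p - 2 * n))^-1 @[p --> +oo] --> (0:R).
  apply: (@cvg_near_eq _ (fun p => (2 `^ (2 * p))^-1 * 2 `^ (2 * n))); last first.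
    by rewrite -(mul0r (2 `^ (2 * n))); apply: cvgMl; exact: cvg_pow2MV.
  by apply: nearW => p; rewrite powRB ?pnatr_eq0 ?implybT // invfM invrK.
have H3 : (n / p) `^ n @[p --> +oo] --> 0.
  by apply: (cvg_ratio_powR (f := fun=> n)); exact: nearW.
have H4 : 2^-1 * (n / p) `^ n @[p --> +oo] --> (0:R).
  by rewrite -(mulr0 2^-1); exact: cvgMr.
rewrite (_ : 1 = 1 + 0 * 1 + 0 :> R); last by ring.
apply: cvg_near_eq (cvgD (cvgD (H1 2) (cvgM H2 (H1 (5 / 4)))) H4).
near=> p; have p0 : 0 < p by near: p; exact: near_gt.
rewrite /Upsilon (_ : 5 * n / (4 * p) = 5 / 4 * (n / p)); last by field; rewrite gt_eqF.
by rewrite -[2 * n / p]mulrA -(addrA 1) -(addrA 1).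
Unshelve. all: by end_near. Qed.

Local Notation sigma := (Num.sqrt (1 + expR (- (3 * n / 4)))).

Lemma cvg_den : 1 <= n ->
  Gminus_den p n / expR (2 * Num.sqrt (n * p)) @[p --> +oo] --> (expR (- n / 2) + sigma) * sigma.
Proof.
move=> n1.
have HU : Num.sqrt (Upsilon p n) @[p --> +oo] --> (1:R).
  rewrite -[X in _ --> X](sqrtr1 R).
  by apply: continuous_cvg (cvg_Upsilon n1); exact: sqrt_continuous.
have HS := cvg_sqrtSigma.
have H1 : (1 + s p) `^ n @[p --> +oo] --> (1:R) by apply: cvg_powR1; exact: cvg_sqrt_ratio.
have HL := cvg_pow_1Dsqrt n0.
rewrite -[expR (- n / 2)]mulr1 -[X in (_ + X) * _]mul1r.
apply: cvg_near_eq (cvgM (cvgD (cvgM HL HU) (cvgM H1 HS)) HS).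
apply: nearW => p.
rewrite expRM_natl /Gminus_den.
set e := expR _; set A := _ `^ p; set B := Num.sqrt (Upsilon _ _); set C := _ `^ n;
  set D := Num.sqrt (Sigma _ _).
change ((A / e * B + C * (D / e)) * (D / e) = (A * B + C * D) * D / e ^+ 2).
by field; rewrite gt_eqF ?expR_gt0.
Qed.

(** The limits of numerator and denominator come out in terms of exp (- 3 n / 4); the stated
form arises from multiplying both by exp (7 n / 8). *)
Lemma exp_factorE : exp_factor n = expR (n / 4) / ((expR (- n / 2) + sigma) * sigma).
Proof.
rewrite /exp_factor.
have S : Num.sqrt (1 + expR (3 * n / 4)) = expR (3 * n / 8) * sigma.
  have -> : 1 + expR (3 * n / 4) = expR (3 * n / 8) ^+ 2 * (1 + expR (- (3 * n / 4))).
    rewrite -expRM_natl mulrDr mulr1 -expRD addrC; congr (expR _ + _); first by field.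
    by rewrite -[LHS](expR0 R); congr expR; field.
  by rewrite sqrtrM ?sqr_ge0 // sqrtr_sqr ger0_norm ?expR_ge0.
rewrite S.
have E1 : 1 + expR (n / 8) * (expR (3 * n / 8) * sigma) = expR (n / 2) * (expR (- n / 2) + sigma).
  rewrite mulrDr mulrA -!expRD; congr (_ + expR _ * _); last by field.
  by rewrite -[LHS](expR0 R); congr expR; field.
rewrite E1.
have -> : expR (9 * n / 8) = expR (n / 4) * expR (n / 2) * expR (3 * n / 8).
  by rewrite -!expRD; congr expR; field.
have s0 : 0 < sigma by rewrite sqrtr_gt0 addr_gt0 // expR_gt0.
move: (expR_gt0 (n / 2)) (expR_gt0 (3 * n / 8)) (expR_gt0 (- n / 2)) (expR_gt0 (n / 4)).
set a := expR _; set b := expR _; set c := expR _; set d := expR _ => a0 b0 c0 d0.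
by field; rewrite !gt_eqF // addr_gt0.
Qed.

End SigmaUpsilonLimits.

(** * Limits of the numerators and of the p-th roots *)

Section NumeratorLimits.
Variable R : realType.
Variable n : R.
Hypothesis n1 : 1 <= n.
Implicit Types p : R.
Let n0 : 0 < n. Proof. exact: lt_le_trans n1. Qed.

Lemma cvg_pow2V : (2 `^ p)^-1 @[p --> +oo] --> (0:R).
Proof.
by apply: cvg_near_eq (cvg_pow2MV ltr01); apply: nearW => p; rewrite mul1r.
Qed.

Lemma cvg_affine (c : R) : 1 + c * (n / p) @[p --> +oo] --> (1:R).
Proof.
rewrite -[X in _ --> X]addr0; apply: cvgD; first exact: cvg_cst.
by rewrite -(mulr0 c); apply: cvgMr; exact: cvg_ratio.
Qed.

Lemma cvg_numerator_dge3 : ((1 + n / (4 * p)) `^ p * 2 `^ p + (1 - (2 `^ p)^-1) * (1 + n / p) `^ p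
  - (n / p) `^ p) / 2 `^ p
  @[p --> +oo] --> expR (n / 4).
Proof.
have H1 := cvg_pow_1Dratio n0 (_ : 0 < 4^-1).
have H2 := cvg_pow_1Dratio n0 ltr01.
have H3 : (n / p) `^ p @[p --> +oo] --> 0.
  by apply: (cvg_ratio_powR n0 (f := id)); near=> p; apply: ltW; near: p; exact: near_gt.
have H0 := cvg_pow2V.
have H4 : 1 - (2 `^ p)^-1 @[p --> +oo] --> (1 - 0 : R).
  by apply: cvgB => //; exact: cvg_cst.
have -> : expR (n / 4) = expR (4^-1 * n) + (1 - 0) * expR (1 * n) * 0 - 0 * 0.
  by rewrite !mulr0 addr0 subr0 mulrC.
apply: cvg_near_eq (cvgB (cvgD (H1 _) (cvgM (cvgM H4 H2) H0)) (cvgM H3 H0)) => //.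
near=> p; have p0 : 0 < p by near: p; exact: near_gt.
rewrite (_ : n / (4 * p) = 4^-1 * (n / p)); last by field; rewrite gt_eqF.
rewrite -{2}[n / p]mul1r.
set a := (_ + _ ) `^ p; set b := (1 + 1 * _) `^ p; set c := (n / p) `^ p; set h := 2 `^ p.
change (a + (1 - h^-1) * b * h^-1 - c * h^-1 = (a * h + (1 - h^-1) * b - c) / h).
by field; rewrite gt_eqF // powR_gt0.
Unshelve. all: by end_near. Qed.

Lemma cvg_numerator_d2 : (15 * (1 + n / (4 * p)) `^ (p - 1) * 2 `^ (p - 2)
      + (1 + n / p) `^ (p - 1)
        * (2 * Num.sqrt (1 + 4 * n / p) - 3 / 2 `^ (p - 1))
      - Num.sqrt (1 + 4 * n / p) * (n / p) `^ (p - 1)) / 2 `^ p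
  @[p --> +oo] --> 15 / 4 * expR (n / 4).
Proof.
have q4 : 0 < 4^-1 :> R by rewrite invr_gt0.
have H1 := cvg_pow_1Dratio n0 q4.
have H2 := cvg_pow_1Dratio n0 ltr01.
have H0 := cvg_pow2V.
have H3 : (n / p) `^ (p - 1) @[p --> +oo] --> 0.
  apply: (cvg_ratio_powR n0 (f := fun p => p - 1)); near=> p; rewrite lerBrDr; apply: ltW; near: p;
    exact: near_gt.
have H5 : Num.sqrt (1 + 4 * (n / p)) @[p --> +oo] --> (1:R).
  rewrite -[X in _ --> X](sqrtr1 R); apply: continuous_cvg (cvg_affine 4); exact: sqrt_continuous.
have V (c : R) : (1 + c * (n / p))^-1 @[p --> +oo] --> (1:R).
  by rewrite -[X in _ --> X]invr1; apply: cvgV; [exact: oner_neq0|exact: cvg_affine].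
have H6 : 2 * Num.sqrt (1 + 4 * (n / p)) - 6 * (2 `^ p)^-1 @[p --> +oo] --> (2 * 1 - 6 * 0 : R).
  by apply: cvgB; exact: cvgMr.
have H7 : 15 / 4 * ((1 + 4^-1 * (n / p)) `^ p * (1 + 4^-1 * (n / p))^-1) @[p --> +oo] -->
  15 / 4 * (expR (4^-1 * n) * 1).
  by apply: cvgMr; apply: cvgM.
have -> : 15 / 4 * expR (n / 4) = 15 / 4 * (expR (4^-1 * n) * 1) + (expR (1 * n) * 1)
  * (2 * 1 - 6 * 0) * 0 - 1 * 0 * 0.
  by rewrite !mulr0 addr0 subr0 mulr1 [n / 4]mulrC.
apply: cvg_near_eq (cvgB (cvgD H7 (cvgM (cvgM (cvgM H2 (V 1)) H6) H0)) (cvgM (cvgM H5 H3) H0)).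
near=> p; have p0 : 0 < p by near: p; exact: near_gt.
have x0 : 0 < n / p by rewrite divr_gt0.
rewrite (_ : n / (4 * p) = 4^-1 * (n / p)); last by field; rewrite gt_eqF.
rewrite -[4 * n / p]mulrA.
have B (c : R) : 0 <= c -> (1 + c * (n / p)) `^ (p - 1) =
  (1 + c * (n / p)) `^ p * (1 + c * (n / p))^-1.
  move=> c0; have c1 : 0 < 1 + c * (n / p) by rewrite ltr_pwDl // mulr_ge0 // ltW.
  by rewrite powRB ?powRr1 ?(ltW c1) // (gt_eqF c1) implybT.
rewrite B ?(ltW q4) //.
rewrite (_ : (1 + n / p) `^ (p - 1) = (1 + 1 * (n / p)) `^ p * (1 + 1 * (n / p))^-1);
  last by rewrite -B // mul1r.
have -> : 2 `^ (p - 2) = 2 `^ p / 4 :> R.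
  rewrite powRB ?pnatr_eq0 ?implybT // (@powR_mulrn _ 2 2) //; congr (_ / _); ring.
have -> : 2 `^ (p - 1) = 2 `^ p / 2 :> R by rewrite powRB ?pnatr_eq0 ?implybT // powRr1.
set a := _ `^ p; set b := (1 + 1 * _) `^ p; set c := (n / p) `^ _; set h := 2 `^ p;
  set v := Num.sqrt _.
set a' := (1 + 4^-1 * _)^-1; set b' := (1 + 1 * _)^-1.
change (15 / 4 * (a * a') + b * b' * (2 * v - 6 * h^-1) * h^-1 - v * c * h^-1 =
  (15 * (a * a') * (h / 4) + (b * b') * (2 * v - 3 / (h / 2)) - v * c) / h).
by field; rewrite gt_eqF // powR_gt0.
Unshelve. all: by end_near. Qed.

(** In the logarithm of the p-th root, the contributions of the constant, of (n / p)^al and of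
exp (- 2 sqrt (n p)) tend to 0, and 2^p contributes ln 2. *)
Lemma sim_root_cvg (K al : R) (g : R -> R) : 0 < K ->
  g p / (K * (n / p) `^ al * (2 `^ p / expR (2 * Num.sqrt (n * p)))) @[p --> +oo] --> (1:R) ->
  g p `^ p^-1 @[p --> +oo] --> (2:R).
Proof.
move=> K0 G1.
set t := fun p => _ in G1.
have pV : p^-1 @[p --> +oo] --> (0:R).
  by apply/(@gtr0_cvgV0 R R (pinfty_nbhs R) _ id); [exact: near_gt|exact: cvg_id].
have L1 : ln (t p) @[p --> +oo] --> (0:R).
  rewrite -[X in _ --> X](ln1 R); apply: continuous_cvg G1.
  exact: continuous_ln.
(* With s = sqrt (n / p), the bound -ln s <= 1 / s gives |ln (n / p)| / p <= 2 s / n. *)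
have L2 : ln (n / p) * p^-1 @[p --> +oo] --> (0:R).
  apply: (@squeeze_cvgr _ _ _ _ (fun p => - (2 / n) * Num.sqrt (n / p)) (fun=> 0)); last 2 first.
  - by rewrite -(mulr0 (- (2 / n))); apply: cvgMr; exact: cvg_sqrt_ratio.
  - exact: cvg_cst.
  near=> p; have p0 : n < p by near: p; exact: near_gt.
  have p1 := lt_trans n0 p0.
  have x0 : 0 < n / p by rewrite divr_gt0.
  have s0 : 0 < Num.sqrt (n / p) by rewrite sqrtr_gt0.
  have pE : p^-1 = Num.sqrt (n / p) ^+ 2 / n.
    by rewrite sqr_sqrtr ?(ltW x0) // mulrAC divff ?mul1r // gt_eqF.
  have lx : - (2 / Num.sqrt (n / p)) <= ln (n / p).
    have h : -1 < (Num.sqrt (n / p))^-1 - 1 by rewrite -[ltLHS]add0r ltrD2r invr_gt0.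
    have := le_ln1Dx h; rewrite addrC subrK lnV ?posrE // => h1.
    have -> : ln (n / p) = 2 * ln (Num.sqrt (n / p)).
      by rewrite -{1}[n / p]sqr_sqrtr ?(ltW x0) // lnXn // mulr_natl.
    rewrite -mulrN ler_pM2l // lerNl; apply: le_trans h1 _.
    by rewrite lerBlDr lerDl.
  apply/andP; split; last by rewrite pmulr_lle0 ?invr_gt0 // ln_le0 // ler_pdivrMr // mul1r ltW.
  rewrite [in leLHS](_ : - (2 / n) * _ = - (2 / Num.sqrt (n / p)) * p^-1); last first.
    by move: s0 pE; set w := Num.sqrt _ => s0 ->; field; rewrite !gt_eqF.
  by rewrite ler_pM2r // invr_gt0.
have L : ln (t p) * p^-1 + ln K * p^-1 + al * (ln (n / p) * p^-1) + ln 2 - 2 * Num.sqrt (n / p)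
  @[p --> +oo]
    --> 0 * 0 + ln K * 0 + al * 0 + ln 2 - 2 * 0.
  apply: cvgB; last by apply: cvgMr; exact: cvg_sqrt_ratio.
  apply: cvgD; last exact: cvg_cst.
  apply: cvgD; last exact: cvgMr.
  by apply: cvgD; [exact: cvgM|exact: cvgMr].
rewrite !mulr0 !addr0 subr0 add0r in L.
apply: (@cvg_near_eq _ (fun p => expR (ln (t p) * p^-1 + ln K * p^-1 + al * (ln (n / p) * p^-1)
  + ln 2 - 2 * Num.sqrt (n / p)))); last first.
  by rewrite -[X in _ --> X](@lnK R 2) ?posrE //; apply: continuous_cvg L; exact: continuous_expR.
near=> p; have p0 : 0 < p by near: p; exact: near_gt.
have x0 : 0 < n / p by rewrite divr_gt0.
have t0 : 0 < t p by near: p; apply: (cvgr_gt _ G1).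
have T0 : 0 < K * (n / p) `^ al * (2 `^ p / expR (2 * Num.sqrt (n * p))).
  by rewrite !mulr_gt0 ?invr_gt0 ?expR_gt0 ?powR_gt0.
have gE : g p = t p * (K * (n / p) `^ al * (2 `^ p / expR (2 * Num.sqrt (n * p)))).
  by rewrite mulfVK // gt_eqF.
have g0 : 0 < g p by rewrite gE mulr_gt0.
have LE : ln (g p) = ln (t p) + (ln K + al * ln (n / p) + (p * ln 2 - 2 * Num.sqrt (n * p))).
  have hx : 0 < (n / p) `^ al by rewrite powR_gt0.
  have h2 : 0 < 2 `^ p :> R by rewrite powR_gt0.
  have hE : 0 < expR (2 * Num.sqrt (n * p)) by exact: expR_gt0.
  rewrite gE (lnM (x := t p)) ?posrE //; congr (_ + _).
  rewrite (lnM (x := K * _)) ?posrE ?mulr_gt0 ?invr_gt0 //.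
  have E1 : ln (K * (n / p) `^ al) = ln K + ln ((n / p) `^ al) by apply: lnM; rewrite posrE.
  have E2 : ln (2 `^ p / expR (2 * Num.sqrt (n * p))) =
    ln (2 `^ p) - ln (expR (2 * Num.sqrt (n * p))).
    by apply: ln_div; rewrite posrE.
  by rewrite E1 E2 !ln_powR expRK.
rewrite [RHS]/powR (gt_eqF g0) LE.
have -> : Num.sqrt (n * p) = p * Num.sqrt (n / p) by near: p; exact: near_sqrt_np.
by congr expR; field; rewrite gt_eqF.
Unshelve. all: by end_near. Qed.

End NumeratorLimits.

(** * Asymptotic equivalents *)

Section Equivalents.
Variable R : realType.
Variable n : R.
Hypothesis n1 : 1 <= n.
Implicit Types p : R.
Let n0 : 0 < n. Proof. exact: lt_le_trans n1. Qed.

Local Notation E := (fun p : R => expR (2 * Num.sqrt (n * p))).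

Lemma exp_factor_gt0 : 0 < exp_factor n.
Proof.
rewrite /exp_factor divr_gt0 ?expR_gt0 // mulr_gt0 ?sqrtr_gt0 ?addr_gt0 ?expR_gt0 //.
Qed.

(** Both lower bounds have this shape: [A] is the factor tending to 1 that occurs only in the
plane, and [k] is the factor 15/4 of the planar numerator (1 otherwise). *)
Lemma sim_Gminus (C al : R) (A M : R -> R) (G : R -> R) (k : R) :
  0 < C -> 0 < k ->
  (\forall p \near +oo, G p = C * (n / p) `^ al * A p * (M p / Gminus_den p n)) ->
  A p @[p --> +oo] --> (1:R) ->
  M p / 2 `^ p @[p --> +oo] --> k * expR (n / 4) ->
  sim_pinfty G (fun p => k * C * exp_factor n * (n / p) `^ al * (2 `^ p / E p)).
Proof.
move=> C0 k0 GE A1 Mk.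
have D := cvg_den n0 n1.
have ef0 := exp_factor_gt0.
set F := (_ * _) in D.
have F0 : 0 < F.
  have s0 : 0 < Num.sqrt (1 + expR (- (3 * n / 4))) by rewrite sqrtr_gt0 addr_gt0 ?expR_gt0.
  by rewrite mulr_gt0 // addr_gt0 // expR_gt0.
have DV : (Gminus_den p n / E p)^-1 @[p --> +oo] --> F^-1.
  by apply: cvgV D; rewrite gt_eqF.
have K : (k * exp_factor n)^-1 * (A p * (M p / 2 `^ p) * (Gminus_den p n / E p)^-1) @[p --> +oo] -->
    (k * exp_factor n)^-1 * (1 * (k * expR (n / 4)) * F^-1).
  by apply: cvgMr; apply: cvgM DV; exact: cvgM.
rewrite /sim_pinfty [X in _ --> X](_ : 1 = (k * exp_factor n)^-1 * (1 * (k * expR (n / 4)) * F^-1));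
  last first.
  rewrite exp_factorE -/F; field.
  by rewrite !gt_eqF ?expR_gt0.
apply: cvg_near_eq K; near=> p.
have pn : n <= p by apply: ltW; near: p; exact: near_gt.
have p0 : 0 < p by exact: lt_le_trans pn.
have -> : G p = C * (n / p) `^ al * A p * (M p / Gminus_den p n) by near: p.
have D0 := Gminus_den_gt0 n0 pn.
have x0 : 0 < (n / p) `^ al by rewrite powR_gt0 // divr_gt0.
have h0 : 0 < 2 `^ p :> R by rewrite powR_gt0.
have e0 : 0 < E p by exact: expR_gt0.
move: ef0 D0 x0 h0 e0; set a := exp_factor n; set b := Gminus_den p n; set c := _ `^ al;
  set h := 2 `^ p; set e := expR _.
by move=> ef0 D0 x0 h0 e0; field; rewrite !gt_eqF.
Unshelve. all: by end_near. Qed.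

Lemma Gminus_dge3_asym (d : nat) :
     sim_pinfty (fun p => Gminus_dge3 d p n)
       (fun p => Num.sqrt 2 / (2 * pi) `^ (d%:R / 2) * exp_factor n
                 * (n / p) `^ (n / 2) * (2 `^ p / expR (2 * Num.sqrt (n * p))))
     /\ Gminus_dge3 d p n `^ p^-1 @[p --> +oo] --> (2 : R).
Proof.
have C0 : 0 < Num.sqrt 2 / (2 * pi) `^ (d%:R / 2) :> R.
  by rewrite divr_gt0 ?sqrtr_gt0 ?powR_gt0 ?mulr_gt0 ?pi_gt0.
have S : sim_pinfty (fun p => Gminus_dge3 d p n)
       (fun p => Num.sqrt 2 / (2 * pi) `^ (d%:R / 2) * exp_factor n
                 * (n / p) `^ (n / 2) * (2 `^ p / expR (2 * Num.sqrt (n * p)))).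
  pose M p := (1 + n / (4 * p)) `^ p * 2 `^ p + (1 - (2 `^ p)^-1) * (1 + n / p) `^ p - (n / p) `^ p.
  have M1 : M p / 2 `^ p @[p --> +oo] --> 1 * expR (n / 4) by rewrite mul1r;
    exact: cvg_numerator_dge3.
  pose one (p : R) := 1 : R.
  have A1 : one p @[p --> +oo] --> (1 : R) by exact: cvg_cst.
  rewrite -[Num.sqrt 2 / _]mul1r; apply: (sim_Gminus C0 ltr01 _ A1 M1).
  by apply: nearW => p; rewrite mulr1.
split=> //; apply: (sim_root_cvg n1 _ S).
by rewrite mulr_gt0 // exp_factor_gt0.
Qed.

Lemma Gminus_d2_asym : 
     sim_pinfty (fun p => Gminus_d2 p n)
       (fun p => 15 / (4 * Num.sqrt 2 * pi) * exp_factor n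
                 * (n / p) `^ (n / 2 + 1)
                 * (2 `^ p / expR (2 * Num.sqrt (n * p))))
     /\ Gminus_d2 p n `^ p^-1 @[p --> +oo] --> (2 : R).
Proof.
have pi0 : 0 < Num.sqrt 2 * pi :> R by rewrite mulr_gt0 ?sqrtr_gt0 ?pi_gt0.
have C0 : 0 < (Num.sqrt 2 * pi)^-1 :> R by rewrite invr_gt0.
have k0 : 0 < 15 / 4 :> R by rewrite divr_gt0.
have S : sim_pinfty (fun p => Gminus_d2 p n)
       (fun p => 15 / (4 * Num.sqrt 2 * pi) * exp_factor n
                 * (n / p) `^ (n / 2 + 1)
                 * (2 `^ p / expR (2 * Num.sqrt (n * p)))).
  have -> : 15 / (4 * Num.sqrt 2 * pi) = 15 / 4 * (Num.sqrt 2 * pi)^-1 :> R.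
    by rewrite -mulrA invfM mulrA.
  pose A p := (Num.sqrt ((1 + n / p) * (1 + 4 * n / p)))^-1.
  have A1 : A p @[p --> +oo] --> (1 : R).
    rewrite -[X in _ --> X]invr1; apply: cvgV; first exact: oner_neq0.
    rewrite -[X in _ --> X](sqrtr1 R).
    apply: (@cvg_near_eq _ (fun p => Num.sqrt ((1 + 1 * (n / p)) * (1 + 4 * (n / p))))).
      by apply: nearW => p; rewrite mul1r mulrA.
    apply: continuous_cvg; first exact: sqrt_continuous.
    by rewrite -[X in _ --> X]mulr1; apply: cvgM; exact: cvg_affine.
  apply: (sim_Gminus C0 k0 _ A1 (cvg_numerator_d2 n1)).
  by apply: nearW => p; rewrite /Gminus_d2 /A invfM [X in X * _ = _]mulrCA [X in X * _ = _]mulrA.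
split=> //; apply: (sim_root_cvg n1 _ S).
apply: mulr_gt0; last exact: exp_factor_gt0.
apply: divr_gt0 => //.
by rewrite -mulrA; exact: mulr_gt0.
Qed.

End Equivalents.

Theorem proposition10p2 (R : realType) :
  (forall d : nat, (3 <= d)%N ->
     forall p n : R, n <= p -> d%:R / 2 + 1 < n ->
     forall G : R, is_sharp_constant d p n G -> Gminus_dge3 d p n <= G)
  /\
  (forall d : nat, (3 <= d)%N ->
     forall n : R, d%:R / 2 + 1 < n ->
     sim_pinfty (fun p => Gminus_dge3 d p n)
       (fun p => Num.sqrt 2 / (2 * pi) `^ (d%:R / 2) * exp_factor n
                 * (n / p) `^ (n / 2) * (2 `^ p / expR (2 * Num.sqrt (n * p))))
     /\ Gminus_dge3 d p n `^ p^-1 @[p --> +oo] --> (2 : R))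
  /\
  (forall p n : R, n <= p -> 2 < n ->
     forall G : R, is_sharp_constant 2 p n G -> Gminus_d2 p n <= G)
  /\
  (forall n : R, 2 < n ->
     sim_pinfty (fun p => Gminus_d2 p n)
       (fun p => 15 / (4 * Num.sqrt 2 * pi) * exp_factor n
                 * (n / p) `^ (n / 2 + 1)
                 * (2 `^ p / expR (2 * Num.sqrt (n * p))))
     /\ Gminus_d2 p n `^ p^-1 @[p --> +oo] --> (2 : R)).
Proof.
split; [|split; [|split]].
- by move=> d d3 p n np dn G [K _]; exact: Gminus_dge3_le.
- move=> d d3 n dn; apply: Gminus_dge3_asym; apply: ltW; apply: le_lt_trans dn.
  by rewrite lerDr divr_ge0.
- by move=> p n np n2 G [K _]; exact: Gminus_d2_le.
- move=> n n2; apply: Gminus_d2_asym; apply: ltW; apply: lt_trans n2.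
  by rewrite ltr1n.
Qed.
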